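(* Let $X\in\mathfrak{q}$ and assume that the orbit $M=\operatorname{Ad}(H)X$ is contained in a pseudo-hypersphere $\boldsymbol{S}=\{v\in\mathfrak{q}\mid B(v,v)=r\}$ with $r>0$. Then $M\hookrightarrow\boldsymbol{S}$ is a pseudo-Riemannian submanifold if and only if $X$ is semisimple.
   Context: $G$ is a connected semisimple noncompact real Lie group, $\sigma$ is an involution of $G$, and $H$ is a closed subgroup of $G$ with $(G_\sigma)_0\subset H\subset G_\sigma$, where $G_\sigma$ is the fixed point group of $\sigma$ and $(G_\sigma)_0$ its identity component. $\mathfrak{g}=\operatorname{Lie}(G)$, $\mathfrak{h}=\operatorname{Lie}(H)$; the induced involution of $\mathfrak{g}$ is also denoted $\sigma$, so $\mathfrak{h}=\{X\in\mathfrak{g}\mid\sigma(X)=X\}$, and $\mathfrak{q}=\{X\in\mathfrak{g}\mid\sigma(X)=-X\}$. $B$ is the Killing form of $\mathfrak{g}$; its restriction to $\mathfrak{q}$ is a (nondegenerate) pseudo-Euclidean inner product. $H$ acts on $\mathfrak{q}$ by the adjoint representation $\operatorname{Ad}$. The pseudo-hypersphere $\boldsymbol{S}$ carries the metric induced from $B|_{\mathfrak{q}}$; ''$M\hookrightarrow\boldsymbol{S}$ is a pseudo-Riemannian submanifold'' means that the induced metric on $M$ is nondegenerate. An element $X\in\mathfrak{q}$ is semisimple if $\operatorname{ad}(X)\in\operatorname{End}(\mathfrak{g})$ is diagonalizable over $\mathbb{C}$. *)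

(* Defs.v *)
From HB Require Import structures.
From mathcomp Require Import all_boot all_order all_algebra.
From mathcomp Require Import complex.
From mathcomp Require Import all_classical all_reals all_analysis.

Set Implicit Arguments.
Unset Strict Implicit.
Unset Printing Implicit Defensive.

Import Order.TTheory GRing.Theory Num.Theory.
Import numFieldNormedType.Exports.

Local Open Scope classical_set_scope.
Local Open Scope ring_scope.

(* Meant for [U] open and [V], [W] finite-dimensional: [f] is of class C^{k+1}
   iff it is differentiable and all its directional derivatives are C^k. *)
Fixpoint class_C (R : realType) (V W : normedModType R) (k : nat)
    (U : set V) (f : V -> W) : Prop :=
  if k is k'.+1 then
    (forall x, U x -> differentiable f x) /\
    (forall v, class_C k' U ('D_v f))
  else {in U, continuous f}.

Definition smooth_on (R : realType) (V W : normedModType R)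
  (U : set V) (f : V -> W) : Prop := forall k, class_C k U f.

(* [chart_fwd] and [chart_bwd] are total functions; only their restrictions to
   [chart_dom] and [chart_cod] are meaningful. *)
Record chart (R : realType) (n : nat) (T : topologicalType) := Chart {
  chart_dom : set T;
  chart_cod : set 'rV[R]_n;
  chart_fwd : T -> 'rV[R]_n;
  chart_bwd : 'rV[R]_n -> T;
  chart_dom_open : open chart_dom;
  chart_cod_open : open chart_cod;
  chart_fwd_cod : forall p, chart_dom p -> chart_cod (chart_fwd p);
  chart_bwd_dom : forall x, chart_cod x -> chart_dom (chart_bwd x);
  chart_fwdK : forall p, chart_dom p -> chart_bwd (chart_fwd p) = p;
  chart_bwdK : forall x, chart_cod x -> chart_fwd (chart_bwd x) = x;
  chart_fwd_continuous : {in chart_dom, continuous chart_fwd};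
  chart_bwd_continuous : {in chart_cod, continuous chart_bwd}
}.

(* Mere juxtaposition of a group law and a topology: their compatibility is
   part of [lie_group]. *)
#[short(type="groupTopologicalType")]
HB.structure Definition GroupTopological := {G of Group G & Topological G}.

Section SmoothMaps.
Variables (R : realType) (n : nat) (G : groupTopologicalType).
Variable A : set (chart R n G).

Definition smooth_map (f : G -> G) : Prop :=
  continuous f /\
  forall c d, A c -> A d ->
    smooth_on [set x | chart_cod c x /\ chart_dom d (f (chart_bwd c x))]
              (fun x => chart_fwd d (f (chart_bwd c x))).

Definition smooth_map2 (f : G -> G -> G) : Prop :=
  continuous (fun z : G * G => f z.1 z.2) /\
  forall c1 c2 d, A c1 -> A c2 -> A d ->
    smooth_on
      [set z : 'rV[R]_n * 'rV[R]_n |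
        [/\ chart_cod c1 z.1, chart_cod c2 z.2 &
            chart_dom d (f (chart_bwd c1 z.1) (chart_bwd c2 z.2))]]
      (fun z => chart_fwd d (f (chart_bwd c1 z.1) (chart_bwd c2 z.2))).

End SmoothMaps.

(* Structure of real Lie group of dimension [n] on [G]. Second countability is
   not required (it is automatic when [G] is connected). The choice of
   [chart1], a chart at the identity, is what identifies T_1 G with R^n. *)
Record lie_group (R : realType) (n : nat) (G : groupTopologicalType) :=
  LieGroup {
    atlas : set (chart R n G);
    chart1 : chart R n G;
    lie_hausdorff : hausdorff_space G;
    atlas_cover : forall p, exists2 c, atlas c & chart_dom c p;
    chart1_atlas : atlas chart1;
    chart1_dom : chart_dom chart1 1%g;
    atlas_compat : smooth_map atlas id;
    lie_mul_smooth : smooth_map2 atlas (fun x y => (x * y)%g);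
    lie_inv_smooth : smooth_map atlas (fun x => x^-1)%g
  }.

Section LieAlgebra.
Variables (R : realType) (n : nat) (G : groupTopologicalType).
Variable L : lie_group R n G.
Implicit Types (X Y u v : 'rV[R]_n) (U : {vspace 'rV[R]_n}).

Local Notation phi := (chart_fwd (chart1 L)).
Local Notation psi := (chart_bwd (chart1 L)).
Local Notation a := (phi 1%g).

(* Differential at 1 of a map f from G to G with f(1) in the domain of
   [chart1], read in that chart. *)
Definition diff1 (f : G -> G) v : 'rV[R]_n :=
  'd (fun x => phi (f (psi x))) a v.

(* The left-invariant vector field with value [v] at 1, in coordinates. *)
Definition left_field v (x : 'rV[R]_n) : 'rV[R]_n :=
  diff1 (fun g => psi x * g)%g v.

(* Value at 1 of the Lie bracket of the left-invariant vector fields; in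
   coordinates the bracket of the fields V and W is DW(V) - DV(W). *)
Definition lie_bracket u v : 'rV[R]_n :=
  'd (left_field v) a u - 'd (left_field u) a v.

Definition ad_mx X : 'M[R]_n := lin1_mx (lie_bracket X).

Definition killing X Y : R := \tr (ad_mx X *m ad_mx Y).

Definition Ad (g : G) : 'rV[R]_n -> 'rV[R]_n :=
  diff1 (fun x => g * x * g^-1)%g.

Definition lie_ideal U : Prop :=
  forall u v, v \in U -> lie_bracket u v \in U.

Definition lie_derived U : {vspace 'rV[R]_n} :=
  <<[seq lie_bracket u v | u <- vbasis U, v <- vbasis U]>>%VS.

Definition lie_solvable U : Prop := exists k, iter k lie_derived U = 0%VS.

Definition semisimple_lie_group : Prop :=
  forall U, lie_ideal U -> lie_solvable U -> U = 0%VS.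

Definition semisimple_element X : Prop :=
  diagonalizable (map_mx (real_complex R) (ad_mx X)).

Definition lie_involution (sigma : G -> G) : Prop :=
  [/\ smooth_map (atlas L) sigma,
      {morph sigma : x y / (x * y)%g} & involutive sigma].

Definition q_space (sigma : G -> G) : set 'rV[R]_n :=
  [set X | diff1 sigma X = - X].

(* Lie algebra of a closed (hence embedded) subgroup [H], as the space of
   velocities at 1 of the smooth curves of G that lie in H. *)
Definition lie_subalgebra (H : set G) : set 'rV[R]_n :=
  [set v | exists (c : R -> G) (e : R),
    [/\ 0 < e, c 0 = 1%g,
        forall t, `|t| < e -> H (c t) /\ chart_dom (chart1 L) (c t),
        smooth_on (ball (0 : R^o) e) (fun t : R^o => phi (c t)) &
        derive1 (fun t : R => phi (c t)) 0 = v]].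

Definition Ad_orbit (H : set G) X : set 'rV[R]_n :=
  [set Ad h X | h in H].

(* Tangent space at [Y] of the orbit of [Y], as an immersed submanifold: the
   image of Lie(H) under the differential at 1 of k |-> Ad(k) Y. *)
Definition orbit_tangent (H : set G) Y : set 'rV[R]_n :=
  [set 'd (fun x => Ad (psi x) Y) a v | v in lie_subalgebra H].

Definition pseudo_hypersphere (sigma : G -> G) (r : R) : set 'rV[R]_n :=
  [set v | q_space sigma v /\ killing v v = r].

(* The metric induced on an orbit by a pseudo-hypersphere containing it is, at
   each point, the restriction of the Killing form to the tangent space. *)
Definition pseudo_riemannian_orbit (H : set G) X : Prop :=
  forall Y, Ad_orbit H X Y ->
  forall u, orbit_tangent H Y u ->
    (forall v, orbit_tangent H Y v -> killing u v = 0) -> u = 0.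

End LieAlgebra.

Section Subgroups.
Variable G : groupTopologicalType.

Definition fixed_points (sigma : G -> G) : set G := [set g | sigma g = g].

Definition closed_subgroup (H : set G) : Prop :=
  [/\ closed H, H 1%g, forall x y, H x -> H y -> H (x * y)%g &
      forall x, H x -> H (x^-1)%g].

End Subgroups.

(* Main.v *)
Require Import Defs.
From HB Require Import structures.
From mathcomp Require Import all_boot all_order all_algebra perm.
From mathcomp Require Import complex.
From mathcomp Require Import all_classical all_reals all_analysis.
From mathcomp Require Import ring.

Set Implicit Arguments.
Unset Strict Implicit.
Unset Printing Implicit Defensive.

Import Order.TTheory GRing.Theory Num.Theory.
Import numFieldNormedType.Exports.

Local Open Scope classical_set_scope.
Local Open Scope ring_scope.

(** The analytic half identifies the tangent space of the orbit at [Y] with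
    [[h, Y]], [h] being the fixed space of the differential of [sigma]. The
    bracket is the derivative of [Ad], homomorphisms preserve it by symmetry of
    second derivatives, and a fixed vector of the differential of [sigma]
    integrates to a curve of fixed points because
    [x |-> (x - a + d sigma (sigma x - a)) / 2] linearizes [sigma] at [a].

    The algebraic half says that [[h, X]] is nondegenerate for the Killing form
    iff [ad X] is diagonalizable over C. The orthogonal of [[h, X]] in [q] is
    the centralizer of [X] in [q], and it meets [[h, X]] trivially when
    [ker (ad X)^2 = ker (ad X)]. Conversely the nilpotent part of [ad X] is an
    inner derivation [ad W] with [W] centralizing [X] and orthogonal to every
    element that commutes with [X], so the real and imaginary parts of [W] lie
    in [[h, X]] and in its orthogonal, and [W = 0].

    Jordan components of derivations, and Cartan's criterion in the form needed
    for nondegeneracy of the Killing form, both come from one construction: an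
    additive [f : C -> C] applied to the eigenvalues of a derivation, with the
    eigenvectors kept, yields a derivation ([f] the identity gives the
    semisimple part, [f] the conjugation gives trace identities). *)

(** * Derivations over an algebraically closed field *)

(** The tangent spaces are real while the eigenvalues of [ad X] need not be, so the Jordan
    decomposition is made over [R[i]], the nilpotent part is shown to be inner in the complexified
    algebra, and only then is it brought back to real vectors. Additivity of [f] matches the Leibniz
    rule: the bracket of generalized eigenvectors for [c] and [d] is one for [c + d]. Conjugation is
    additive though not C-linear, and pairing an eigenvalue with its conjugate makes traces
    positive. [lie_subalgebra] is defined by curves that lie in the subgroup, so a fixed vector must
    be realized by an actual smooth curve; this is what calls for a local inverse and for its
    smoothness. The bracket and the derivative of [Ad] involve only second derivatives at the
    identity. Vectors are rows: [ad u] acts from the right, [br u v = v *m ad u], and [ad] therefore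
    turns a bracket into the commutator in reversed order. *)

Lemma mxtrace_nilpotent (F : closedFieldType) n (A : 'M[F]_n.+1) k :
  A ^+ k = 0 -> \tr A = 0.
Proof.
move=> Ak0; have [rs] := closed_field_poly_normal (char_poly A).
rewrite (monicP (char_poly_monic A)) scale1r => Ers.
have rs0 z : z \in rs -> z = 0.
  rewrite -root_prod_XsubC -Ers -eigenvalue_root_char => /eigenvalueP[v vA v0].
  have: v *m A ^+ k = z ^+ k *: v.
    elim: k {Ak0} => [|k IHk]; first by rewrite mulmx1 scale1r.
    by rewrite exprSr mulmxA IHk -scalemxAl vA scalerA -exprSr.
  rewrite Ak0 mulmx0 => /esym/eqP; rewrite scaler_eq0 (negPf v0) orbF.
  by rewrite expf_eq0 => /andP[_ /eqP].
have {}Ers : char_poly A = 'X^(n.+1).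
  rewrite Ers (eq_big_seq (fun=> 'X)); last first.
    by move=> z /rs0 ->; rewrite subr0.
  rewrite big_const_seq count_predT iter_mulr_1.
  have := congr1 (fun p : {poly F} => size p) Ers.
  by rewrite size_char_poly size_prod_XsubC => -[->].
have := char_poly_trace A (ltn0Sn n); rewrite Ers coefXn /= ltn_eqF //.
by move/esym/eqP; rewrite oppr_eq0 => /eqP.
Qed.

(** The multiplicity [N] makes [p] act as the scalar [f c] on generalized eigenvectors for [c], not
    only on eigenvectors. *)
Lemma poly_interpolate (F : fieldType) (f : F -> F) N (s : seq F) :
  exists p, forall c, c \in s -> ('X - c%:P) ^+ N %| p - (f c)%:P.
Proof.
suff [p pP] : exists p, forall c, c \in undup s ->
    ('X - c%:P) ^+ N %| p - (f c)%:P.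
  by exists p => c cs; apply: pP; rewrite mem_undup.
elim: (undup s) (undup_uniq s) => [_|c t IHt /= /andP[ct /IHt[p pP]]].
  by exists 0.
pose Q := \prod_(d <- t) ('X - d%:P) ^+ N.
have : coprimep Q (('X - c%:P) ^+ N).
  rewrite /Q (@big_morph _ _ (fun q => coprimep q _) true andb); last 2 first.
  - by move=> a b; rewrite coprimepMl.
  - by rewrite coprime1p.
  rewrite big_all; apply/allP => d dt.
  rewrite coprimep_expl // coprimep_expr // coprimep_XsubC root_XsubC.
  by apply: contraNneq ct => ->.
move=> /Bezout_eq1_coprimepP[[u v] /= uv].
(* By Bezout [u * Q] is 1 modulo the new power and 0 modulo the old ones: the correction fixes the
   value at [c] and leaves the others alone. *)
exists (p + u * Q * ((f c)%:P - p)) => d; rewrite inE => /predU1P[->|dt].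
  have -> : p + u * Q * ((f c)%:P - p) - (f c)%:P =
      v * ('X - c%:P) ^+ N * (p - (f c)%:P).
    move/(congr1 (fun q => q - u * Q)): uv; rewrite addrAC subrr add0r => ->.
    rewrite mulrBl mul1r -[X in - (_ * X)]opprB mulrN.
    by rewrite opprK addrAC addrC addrA.
  by rewrite -mulrA dvdp_mull // dvdp_mulr.
rewrite addrAC dvdp_add // ?pP //.
rewrite dvdp_mulr // dvdp_mull // /Q (big_rem d) //= dvdp_mulr //.
Qed.

Section GeneralizedEigenvectors.
Variables (F : closedFieldType) (n : nat) (A : 'M[F]_n.+1).

Definition gker c N := kermx ((A - c%:M) ^+ N).

(** The minimal polynomial divides the characteristic one, whose roots have multiplicity at most its
    degree [n.+1]; this single exponent serves every eigenvalue. *)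
Lemma gker_full : exists2 s, uniq s &
  (1%:M <= \sum_(c <- s) gker c n.+1)%MS.
Proof.
have [rs] := closed_field_poly_normal (char_poly A).
rewrite (monicP (char_poly_monic A)) scale1r => Ers.
exists (undup rs); first exact: undup_uniq.
pose m := size (undup rs); pose r i := (undup rs)`_i.
have -> : (\sum_(c <- undup rs) gker c n.+1)%MS =
    (\sum_(i < m) kermxpoly A (('X - (r i)%:P) ^+ n.+1))%MS.
  rewrite (big_nth 0) big_mkord; apply: eq_bigr => i _.
  by rewrite /gker -geigenspaceE.
rewrite -(kermxpoly_prod A); last first.
  move=> i j _ _ ji; rewrite coprimep_expl // coprimep_expr //.
  by rewrite coprimep_XsubC root_XsubC nth_uniq ?undup_uniq.
rewrite kermxpoly_min //; apply: dvdp_trans (mxminpoly_dvd_char A) _.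
have szrs : size rs = n.+1.
  have := congr1 (fun p : {poly F} => size p) Ers.
  by rewrite size_char_poly size_prod_XsubC => -[].
rewrite Ers -(big_mkord xpredT (fun i => ('X - (r i)%:P) ^+ n.+1)).
rewrite -(big_nth 0 xpredT (fun c => ('X - c%:P) ^+ n.+1)) /=.
rewrite -big_undup_iterop_count /=.
elim: (undup rs) => [|c t IHt]; first by rewrite !big_nil.
rewrite !big_cons dvdp_mul //.
by rewrite Monoid.iteropE iter_mulr_1 dvdp_exp2l // -szrs count_size.
Qed.

Lemma gker_ind (P : 'rV[F]_n.+1 -> Prop) (s : seq F) :
  (1%:M <= \sum_(c <- s) gker c n.+1)%MS ->
  P 0 -> (forall u v, P u -> P v -> P (u + v)) ->
  (forall c v, c \in s -> v *m (A - c%:M) ^+ n.+1 = 0 -> P v) ->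
  forall v, P v.
Proof.
move=> s1 P0 PD Ps v.
have : (v <= \sum_(c <- s) gker c n.+1)%MS by rewrite (submx_trans (submx1 v)).
elim: s Ps {s1} v => [_ v|c s IHs Ps v]; first by rewrite big_nil submx0 => /eqP->.
rewrite big_cons => /sub_addsmxP[[w1 w2] /= ->]; apply: PD.
  by apply: (Ps c); rewrite ?mem_head // -mulmxA mulmx_ker mulmx0.
apply: IHs => [d u ds|]; first by apply: Ps; rewrite inE ds orbT.
exact: submxMl.
Qed.

End GeneralizedEigenvectors.

Section Derivations.
Variables (F : closedFieldType) (n : nat).
Variable ad : {linear 'rV[F]_n.+1 -> 'M[F]_n.+1}.

(** Leibniz rule for the product [v *m ad u], with [D] acting on rows: at a row [v] it reads [uD, v]
    = [u, v]D - [u, vD]. *)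
Definition derivation_mx (D : 'M[F]_n.+1) :=
  forall u, ad (u *m D) = ad u *m D - D *m ad u.

Lemma derivation_mx_delta (D : 'M[F]_n.+1) :
  (forall i, ad (delta_mx 0 i *m D) =
     ad (delta_mx 0 i) *m D - D *m ad (delta_mx 0 i)) ->
  derivation_mx D.
Proof.
move=> DE u; rewrite {1 2 3}[u]row_sum_delta mulmx_suml !(linear_sum ad) /=.
rewrite mulmx_suml mulmx_sumr -sumrB; apply: eq_bigr => i _.
by rewrite -scalemxAl ![ad (_ *: _)]linearZ /= DE -scalemxAl -scalemxAr scalerBr.
Qed.

Lemma ad_intertwine_delta (s : 'M[F]_n.+1) :
  (forall i, ad (delta_mx 0 i *m s) = s *m ad (delta_mx 0 i) *m s) ->
  forall u, ad (u *m s) = s *m ad u *m s.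
Proof.
move=> sE u; rewrite {1 2}[u]row_sum_delta mulmx_suml !(linear_sum ad) /=.
rewrite mulmx_sumr mulmx_suml; apply: eq_bigr => i _.
by rewrite -scalemxAl ![ad (_ *: _)]linearZ /= sE -scalemxAr -scalemxAl.
Qed.

Lemma derivation_mx_linear a D1 D2 :
  derivation_mx D1 -> derivation_mx D2 -> derivation_mx (a *: D1 + D2).
Proof.
move=> d1 d2 u; rewrite mulmxDr -scalemxAr linearP /= d1 d2 mulmxDr mulmxDl.
by rewrite -scalemxAl -scalemxAr opprD addrACA scalerBr.
Qed.

Lemma derivation_mxB D1 D2 :
  derivation_mx D1 -> derivation_mx D2 -> derivation_mx (D1 - D2).
Proof.
by move=> d1 d2; rewrite addrC -scaleN1r; apply: derivation_mx_linear.
Qed.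

(** By the Leibniz rule A - (c + d) acts on the product as A - c on one factor plus A - d on the
    other. Each application lowers [i] or [j], so [i + j] of them suffice. *)
Lemma derivation_gker A c d i j (u v : 'rV_n.+1) : derivation_mx A ->
  u *m (A - c%:M) ^+ i = 0 -> v *m (A - d%:M) ^+ j = 0 ->
  (v *m ad u) *m (A - (c + d)%:M) ^+ (i + j) = 0.
Proof.
move=> dA; move Ek : (i + j)%N => k.
elim: k => [|k IHk] in i j Ek u v *.
  by case: i Ek => // _; rewrite mulmx1 => -> _; rewrite linear0 mulmx0 mul0mx.
case: i Ek => [_|i Ek].
  by rewrite mulmx1 => -> _; rewrite linear0 mulmx0 mul0mx.
case: j Ek => [_ _|j Ek].
  by rewrite mulmx1 => ->; rewrite !mul0mx.
move=> u0 v0.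
have -> : v *m ad u *m (A - (c + d)%:M) ^+ k.+1 =
    (v *m ad (u *m (A - c%:M)) + v *m (A - d%:M) *m ad u)
     *m (A - (c + d)%:M) ^+ k.
  rewrite exprS mulmxA; congr (_ *m _).
  rewrite !mulmxBr !mul_mx_scalar linearB [ad (c *: u)]linearZ /= dA !mulmxBr mulmxBl.
  rewrite -scalemxAr -scalemxAl !mulmxA scalerDl opprD.
  by rewrite [RHS]addrACA subrK.
rewrite mulmxDl (IHk i j.+1) ?(IHk i.+1 j) ?addr0 //.
- by case: Ek; rewrite addSnnS.
- by rewrite -mulmxA mulmxE -exprS.
- by case: Ek.
- by rewrite -mulmxA mulmxE -exprS.
Qed.

(* [c] ranges over an arbitrary finite list in addition to the eigenvalues, so
   that the values of [f] at prescribed points are at hand. *)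
Lemma derivation_additive (A : 'M[F]_n.+1) (f : F -> F) (L : seq F) :
  derivation_mx A -> {morph f : x y / x + y} ->
  exists2 p, derivation_mx (horner_mx A p) &
    forall c (v : 'rV_n.+1), c \in L -> v *m (A - c%:M) ^+ n.+1 = 0 ->
      v *m horner_mx A p = f c *: v.
Proof.
move=> dA fD; have [s _ s1] := gker_full A.
(* Products of two generalized eigenvectors require the values at the sums [c + d], and they are
   known to be killed only by the exponent [n.+1 + n.+1]. *)
have [p pP] := poly_interpolate f (n.+1 + n.+1)
  (L ++ s ++ [seq c + d | c <- s, d <- s]).
have pE c (v : 'rV_n.+1) : c \in L ++ s ++ [seq c + d | c <- s, d <- s] ->
    v *m (A - c%:M) ^+ (n.+1 + n.+1) = 0 -> v *m horner_mx A p = f c *: v.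
  move=> /pP /dvdpP[q pq] v0; apply/eqP; rewrite -subr_eq0; apply/eqP.
  rewrite -mul_mx_scalar -mulmxBr -(horner_mx_C A) -rmorphB /= pq mulrC rmorphM.
  by rewrite rmorphXn rmorphB /= horner_mx_X horner_mx_C mulmxA v0 mul0mx.
have gE c (v : 'rV_n.+1) : c \in L ++ s ++ [seq c + d | c <- s, d <- s] ->
    v *m (A - c%:M) ^+ n.+1 = 0 -> v *m horner_mx A p = f c *: v.
  by move=> cs v0; apply: pE => //; rewrite exprD mulmxA v0 mul0mx.
exists p; last by move=> c v cL; apply: gE; rewrite mem_cat cL.
set D := horner_mx A p => u.
suff E (w : 'rV_n.+1) : w *m ad (u *m D) = w *m (ad u *m D - D *m ad u).
  by apply/row_matrixP => i; rewrite !rowE E.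
pose P (w : 'rV[F]_n.+1) := w *m ad (u *m D) = w *m (ad u *m D - D *m ad u).
move: w; apply: (gker_ind (P := P) s1); rewrite /P {P}.
  by rewrite !mul0mx.
  by move=> w1 w2 E1 E2; rewrite !mulmxDl E1 E2.
move=> d w ds w0; pose P (u : 'rV[F]_n.+1) := w *m ad (u *m D) = w *m (ad u *m D - D *m ad u).
move: u; apply: (gker_ind (P := P) s1); rewrite /P {P}.
- by rewrite mul0mx raddf0 !(mul0mx, mulmx0, subr0).
- move=> u1 u2 E1 E2; rewrite (mulmxDl u1 u2 D) !(raddfD ad) /=.
  rewrite [LHS]mulmxDr E1 E2 -mulmxDr.
  by congr (_ *m _); rewrite mulmxDl mulmxDr opprD addrACA.
move=> c u cs u0.
rewrite (gE c u) // ?mem_cat ?cs ?orbT // linearZ /= mulmxBr !mulmxA.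
rewrite (gE d w) // ?mem_cat ?ds ?orbT //.
rewrite (pE (c + d) (w *m ad u)).
- by rewrite fD scalerDl -scalemxAl addrK -scalemxAr.
- by rewrite !mem_cat (allpairs_f (fun x y => x + y)) ?orbT.
exact: derivation_gker.
Qed.

End Derivations.

(** In the common eigenbasis the trace is the sum of the squared moduli of the entries of [d], which
    vanishes only if all of them do. *)
Lemma conj_diag_trace (C : numClosedFieldType) n (S D P : 'M[C]_n) (d : 'rV_n) :
  P \in unitmx -> P *m S = diag_mx d *m P ->
  P *m D = diag_mx (map_mx Num.conj d) *m P ->
  \tr (S *m D) = 0 -> S = 0.
Proof.
move=> Pu PS PD; have -> : S = invmx P *m diag_mx d *m P.
  by rewrite -mulmxA -PS mulKmx.
have -> : D = invmx P *m diag_mx (map_mx Num.conj d) *m P.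
  by rewrite -mulmxA -PD mulKmx.
rewrite -!mulmxA mulKVmx // mxtrace_mulC -!mulmxA mulmxV // mulmx1 mulmx_diag.
rewrite mxtrace_diag => /eqP; rewrite psumr_eq0 => [|i _]; last first.
  by rewrite !mxE -normCK exprn_ge0.
move=> /allP d0; suff -> : d = 0 by rewrite linear0 mul0mx mulmx0.
apply/rowP => i; have := d0 i (mem_index_enum _).
by rewrite !mxE /= -normCK expf_eq0 /= normr_eq0 => /eqP.
Qed.

Section DerivationJordan.
Variables (C : numClosedFieldType) (n : nat).
Variable ad : {linear 'rV[C]_n.+1 -> 'M[C]_n.+1}.

Lemma derivation_jordan (A : 'M[C]_n.+1) : derivation_mx ad A ->
  exists p, let S := horner_mx A p in
  [/\ derivation_mx ad S, diagonalizable S, (A - S) ^+ n.+1 = 0 &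
    forall s, s *m s = 1%:M -> s *m A *m s = - A -> s *m S *m s = - S].
Proof.
move=> dA; have [s us s1] := gker_full A.
(* An involution that anticommutes with [A] exchanges the generalized eigenspaces of [c] and [- c];
   the opposites are listed so that [S] is known there too. *)
have [p dS SE] := derivation_additive (f := id) (s ++ map -%R s) dA
  (fun _ _ => erefl).
exists p => /=; set S := horner_mx A p; split=> //.
  apply/diagonalizablePeigen; exists s => //.
  apply/eqmxP; rewrite submx1 (submx_trans s1) //.
  rewrite (big_nth 0) [X in (_ <= X)%MS](big_nth 0) !big_mkord.
  apply/sumsmx_subP => i _.
  apply: (sumsmx_sup i) => //; apply/rV_subP => v /sub_kermxP v0.
  by apply/eigenspaceP; apply: SE => //; rewrite mem_cat mem_nth.
suff E (v : 'rV_n.+1) : v *m (A - S) ^+ n.+1 = 0.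
  by apply/row_matrixP => i; rewrite rowE E row0.
move: v; apply: (gker_ind (P := fun v => v *m (A - S) ^+ n.+1 = 0) s1).
  by rewrite mul0mx.
  by move=> u v u0 v0; rewrite mulmxDl u0 v0 addr0.
move=> c v cs v0.
have vk0 k : v *m (A - c%:M) ^+ k *m (A - c%:M) ^+ n.+1 = 0.
  by rewrite -mulmxA mulmxE -exprD addnC exprD -mulmxE mulmxA v0 mul0mx.
suff -> : v *m (A - S) ^+ n.+1 = v *m (A - c%:M) ^+ n.+1 by [].
have : forall k, v *m (A - S) ^+ k = v *m (A - c%:M) ^+ k.
  elim=> // k IHk; rewrite exprSr mulmxA IHk [in RHS]exprSr mulmxA.
  by rewrite !mulmxBr (SE c) ?mul_mx_scalar // mem_cat cs.
exact.
move=> t tt tAt; suff E (v : 'rV_n.+1) : v *m (t *m S *m t) = v *m - S.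
  by apply/row_matrixP => i; rewrite !rowE E.
have tA : t *m A = - A *m t by rewrite -tAt -!mulmxA tt mulmx1.
have tS c k (w : 'rV_n.+1) :
    w *m t *m (A - (- c)%:M) ^+ k = (-1) ^+ k *: (w *m (A - c%:M) ^+ k *m t).
  elim: k => [|k IHk]; first by rewrite !mulmx1 scale1r.
  rewrite [in LHS]exprSr mulmxA IHk -scalemxAl [in RHS]exprSr.
  rewrite [in RHS]exprSr -scalerA scaleN1r; congr (_ *: _).
  rewrite -!mulmxA -mulmxN; congr (_ *m _); rewrite -mulmxN; congr (_ *m _).
  rewrite mulmxBr tA mulmxBl opprB mul_mx_scalar mul_scalar_mx scaleNr opprK.
  by rewrite mulNmx addrC.
move: v; apply: (gker_ind (P := fun v => v *m (t *m S *m t) = v *m - S) s1).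
- by rewrite !mul0mx.
- by move=> u v Eu Ev; rewrite !(mulmxDl u) Eu Ev.
move=> c v cs v0; rewrite mulmxN (SE c) ?mem_cat ?cs // !mulmxA.
rewrite (SE (- c)) ?mem_cat ?map_f ?orbT //.
  by rewrite -scalemxAl -mulmxA tt mulmx1 scaleNr.
by rewrite tS v0 mul0mx scaler0.
Qed.

(** Cartan's criterion. The test derivation [D] has the eigenvectors of the semisimple part [S] and
    the conjugate eigenvalues, so that [\tr (S *m D)] is a sum of squared moduli. *)
Lemma derivation_trace_nilpotent (A : 'M[C]_n.+1) : derivation_mx ad A ->
  (forall D, derivation_mx ad D -> \tr (A *m D) = 0) -> A ^+ n.+1 = 0.
Proof.
move=> dA tr0; have [p [dS [P Pu diagP] nilN _]] := derivation_jordan dA.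
set S := horner_mx A p in dS diagP nilN.
have [d /(simmxP Pu) PS] := diagonalizable_forPex diagP.
have [q dD DE] := derivation_additive (f := Num.conj)
  [seq d 0 i | i <- enum 'I_n.+1] dS (rmorphD _).
set D := horner_mx S q in dD DE.
have PD : P *m D = diag_mx (map_mx Num.conj d) *m P.
  apply/row_matrixP => i; rewrite !row_mul row_diag_mx mxE -scalemxAl -rowE.
  apply: DE; first by apply: map_f; rewrite mem_enum.
  rewrite exprS mulmxA mulmxBr -row_mul PS row_mul row_diag_mx -scalemxAl.
  by rewrite -rowE mul_mx_scalar subrr mul0mx.
suff S0 : S = 0 by rewrite S0 subr0 in nilN.
apply: (conj_diag_trace Pu PS PD).
have := tr0 D dD; rewrite -{1}[A](subrK S) mulmxDl mxtraceD.
(* [A - S] is nilpotent and commutes with [D], which is a polynomial in [S]; their product adds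
   nothing to the trace. *)
rewrite (mxtrace_nilpotent (k := n.+1)) ?add0r //.
have cND : GRing.comm (A - S) D.
  apply: comm_mx_horner; apply: comm_mx_sym; apply: comm_mxB => //.
  by apply: comm_mx_sym; apply: comm_mx_horner.
by rewrite mulmxE exprMn_comm // nilN mul0r.
Qed.

End DerivationJordan.

(** * Killing form and Engel's theorem *)

Section LieAlgebra.
Variables (F : fieldType) (n : nat).
Local Notation V := 'rV[F]_n.+1.
Variable ad : {linear V -> 'M[F]_n.+1}.
Variable br : V -> V -> V.
Hypothesis brE : forall u v, br u v = v *m ad u.
Hypothesis br_xx : forall u, br u u = 0.
Hypothesis ad_br : forall u v, ad (br u v) = ad v *m ad u - ad u *m ad v.
Implicit Types (u v w x y z : V) (M P U : {vspace V}).

Definition killing_form u v : F := \tr (ad u *m ad v).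

Definition derived_algebra U : {vspace V} :=
  <<[seq br u v | u <- vbasis U, v <- vbasis U]>>%VS.

Lemma br_linearr a u v w : br w (a *: u + v) = a *: br w u + br w v.
Proof. by rewrite !brE mulmxDl scalemxAl. Qed.

Lemma br_linearl a u v w : br (a *: u + v) w = a *: br u w + br v w.
Proof. by rewrite !brE linearP mulmxDr scalemxAr. Qed.

Lemma brDl u v w : br (u + v) w = br u w + br v w.
Proof. by have := br_linearl 1 u v w; rewrite !scale1r. Qed.

Lemma brDr u v w : br w (u + v) = br w u + br w v.
Proof. by have := br_linearr 1 u v w; rewrite !scale1r. Qed.

Lemma brZl a u w : br (a *: u) w = a *: br u w.
Proof. by rewrite !brE linearZ scalemxAr. Qed.

Lemma brZr a u w : br w (a *: u) = a *: br w u.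
Proof. by rewrite !brE scalemxAl. Qed.

Lemma brC u v : br u v = - br v u.
Proof.
by have /eqP := br_xx (u + v); rewrite brDl !brDr !br_xx add0r addr0 addr_eq0 => /eqP.
Qed.

Lemma br_jacobi u v w : br u (br v w) = br (br u v) w + br v (br u w).
Proof.
by rewrite !brE -[v *m ad u]brE ad_br mulmxBr !mulmxA subrK.
Qed.

Lemma killing_formC u v : killing_form u v = killing_form v u.
Proof. exact: mxtrace_mulC. Qed.

Lemma killing_formDl u v w :
  killing_form (u + v) w = killing_form u w + killing_form v w.
Proof. by rewrite /killing_form (raddfD ad) mulmxDl mxtraceD. Qed.

Lemma killing_formNl u w : killing_form (- u) w = - killing_form u w.
Proof. by rewrite /killing_form (raddfN ad) mulNmx raddfN. Qed.

Lemma killing_form_br u v w :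
  killing_form (br u v) w = - killing_form v (br u w).
Proof.
rewrite /killing_form !ad_br mulmxBl mulmxBr !(raddfB (@mxtrace _ _)) /= opprB.
by congr (_ - _); rewrite -mulmxA // mxtrace_mulC -mulmxA.
Qed.

Lemma br_sub_derived U u v : u \in U -> v \in U -> br u v \in derived_algebra U.
Proof.
move=> /coord_vbasis -> /coord_vbasis ->.
have brS m w (f : 'I_m -> V) : br (\sum_i f i) w = \sum_i br (f i) w.
  by rewrite brE linear_sum mulmx_sumr; apply: eq_bigr => i _; rewrite brE.
rewrite brS; apply: memv_suml => i _.
rewrite brZl brE mulmx_suml memvZ //; apply: memv_suml => j _.
rewrite -scalemxAl memvZ // -brE memv_span //.
by apply: allpairs_f; apply: mem_nth; rewrite size_tuple.
Qed.

Lemma derived_sub U M :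
  (forall u v, u \in U -> v \in U -> br u v \in M) -> (derived_algebra U <= M)%VS.
Proof.
by move=> UM; apply/span_subvP => w /allpairsP[[u v] /= [/vbasis_mem uU /vbasis_mem vU ->]]; apply: UM.
Qed.

Definition stable M U := forall m u, m \in M -> u \in U -> br m u \in U.

Definition nil_algebra M := forall m, m \in M -> exists k, ad m ^+ k = 0.

Lemma iter_br k m u : iter k (br m) u = u *m ad m ^+ k.
Proof.
by elim: k => [|k IHk]; rewrite ?mulmx1 //= IHk brE exprSr mulmxA.
Qed.

Lemma memv_add_line U z w : w \in (U + <[z]>)%VS ->
  exists2 u, u \in U & exists a, w = u + a *: z.
Proof.
by move=> /memv_addP[u uU [_ /vlineP[a ->] ->]]; exists u => //; exists a.
Qed.

Lemma dimv_add_line U z : z \notin U -> (\dim U < \dim (U + <[z]>))%N.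
Proof.
move=> zU; rewrite ltnNge; apply: contra zU => le.
have /eqP -> : (U == U + <[z]>)%VS by rewrite eqEdim addvSl.
by rewrite (subvP (addvSr _ _)) // memv_line.
Qed.

(** A relative form that avoids quotients: [M] kills the class of [z] in U/U'. The property is
    proved for growing subalgebras M' of [M]: applied to the action of M' on M/M', it gives a [z] in
    [M] that normalizes M', and it then passes to M' + <z>. *)
Lemma engel M : stable M M -> nil_algebra M ->
  forall U' U, stable M U' -> stable M U -> (U' <= U)%VS -> U' != U ->
  exists2 z, z \in U & z \notin U' /\ forall m, m \in M -> br m z \in U'.
Proof.
move=> MM nilM.
pose engel_for M' := forall U' U, stable M' U' -> stable M' U ->
  (U' <= U)%VS -> U' != U ->
  exists2 z, z \in U & z \notin U' /\ forall m, m \in M' -> br m z \in U'.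
suff /(_ (\dim M)) [M' [M'M _ engelM' le]] : forall k, exists M' : {vspace V},
    [/\ (M' <= M)%VS, stable M' M', engel_for M' & (minn k (\dim M) <= \dim M')%N].
  suff <- : M' = M by [].
  by apply/eqP; rewrite eqEdim M'M; rewrite minnn in le.
elim=> [|k [M' [M'M M'M' engelM' le]]].
  exists 0%VS; split; rewrite ?sub0v ?min0n //.
    by move=> m u /[!memv0] /eqP -> /eqP ->; rewrite brE mul0mx.
  move=> U' U _ _ U'U nU'U.
  have /subvPn[z zU zU'] : ~~ (U <= U')%VS.
    by apply: contra nU'U => UU'; rewrite eqEsubv U'U.
  by exists z => //; split=> // m /[!memv0] /eqP ->; rewrite brE linear0 mulmx0 mem0v.
have [EM|nM'M] := eqVneq M' M.
  by exists M'; split=> //; rewrite EM geq_minr.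
have [|z zM [zM' M'z]] := engelM' M' M M'M' _ M'M nM'M.
  by move=> m u /(subvP M'M); apply: MM.
exists (M' + <[z]>)%VS; split.
- by rewrite subv_add M'M -memvE.
- move=> _ _ /memv_add_line[u uM' [a ->]] /memv_add_line[v vM' [b ->]].
  apply: (subvP (addvSl _ _)).
  rewrite brDl !brDr !brZl !brZr.
  by rewrite br_xx [br z v]brC !scaler0 addr0 !rpredD ?rpredZ ?rpredN ?M'z ?M'M'.
- move=> U' U sU' sU U'U nU'U.
  have zS W : stable (M' + <[z]>)%VS W -> forall k w, w \in W -> iter k (br z) w \in W.
    move=> sW; elim=> // i IHi w wW /=; apply: sW; last exact: IHi.
    by rewrite (subvP (addvSr _ _)) // memv_line.
  have M'S W : stable (M' + <[z]>)%VS W -> stable M' W.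
    by move=> sW m u /(subvP (addvSl M' <[z]>)); apply: sW.
  have [w wU [wU' M'w]] := engelM' U' U (M'S _ sU') (M'S _ sU) U'U nU'U.
  have M'zw i m : m \in M' -> br m (iter i (br z) w) \in U'.
    elim: i m => [|i IHi] m mM' /=; first exact: M'w.
    rewrite br_jacobi rpredD //.
      exact: IHi (M'z _ mM').
    by apply: sU'; rewrite ?IHi // (subvP (addvSr _ _)) // memv_line.
  have [k0 adz0] := nilM _ zM.
  have ex : exists i, iter i (br z) w \in U' by exists k0; rewrite iter_br adz0 mulmx0 mem0v.
  (* The last iterate of [br z] on [w] outside [U'] is sent into [U'] by [z], and still by [M']
     thanks to [M'zw]. *)
  case: (ex_minnP ex) => -[|i] iU' imin; first by rewrite /= (negPf wU') in iU'.
  exists (iter i (br z) w); first exact: zS.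
  split; first by apply/negP => /imin; rewrite ltnn.
  move=> _ /memv_add_line[m mM' [a ->]].
  by rewrite brDl brZl rpredD ?M'zw // rpredZ.
apply: leq_trans (_ : (minn k (\dim M)).+1 <= _)%N.
  by rewrite -minnSS leq_min geq_minl (leq_trans (geq_minr _ _)).
exact: leq_ltn_trans le (dimv_add_line zM').
Qed.

(** If [P] were nonzero, a proper ideal [U] of it could be enlarged forever: Engel adjoins a [z]
    with [P, z] inside [U], and [U + <[z]>] is again proper, since otherwise [P, P] would lie in [U]
    and perfection would give [U = P]. *)
Lemma perfect_nil_algebra P : stable P P -> nil_algebra P ->
  (P <= derived_algebra P)%VS -> P = 0%VS.
Proof.
move=> PP nilP perfP; apply/eqP; apply: contraT => nP0.
suff /(_ (\dim P).+1) [U [UP _ _]] : forall k, exists U : {vspace V},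
    [/\ (U <= P)%VS, stable P U, U != P & (k <= \dim U)%N].
  by rewrite leqNgt ltnS dimvS.
elim=> [|k [U [UP sU nUP le]]].
  exists 0%VS; split; rewrite ?sub0v // 1?eq_sym //.
  by move=> m u _ /[!memv0] /eqP ->; rewrite brE mul0mx.
have [z zP [zU Pz]] := engel PP nilP sU PP UP nUP.
exists (U + <[z]>)%VS; split; last exact: leq_ltn_trans le (dimv_add_line zU).
- by rewrite subv_add UP -memvE.
- move=> m _ mP /memv_add_line[u uU [a ->]]; apply: (subvP (addvSl _ _)).
  by rewrite brDr brZr rpredD ?rpredZ ?Pz ?sU.
apply: contra nUP => /eqP EP; rewrite eqEsubv UP /=.
apply: subv_trans perfP _; apply: derived_sub => u v uP vP.
move: (vP); rewrite -EP => /memv_add_line[w wU [a ->]].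
by rewrite brDr brZr rpredD ?rpredZ ?Pz ?sU.
Qed.

Lemma derived_ideal U : (forall u v, u \in U -> br u v \in U) ->
  forall u v, u \in derived_algebra U -> br u v \in derived_algebra U.
Proof.
move=> iU u v /(@coord_span _ _ _ (in_tuple _)) ->.
rewrite brE linear_sum mulmx_sumr; apply: memv_suml => i _.
rewrite -brE brZl memvZ //.
have := mem_nth 0 (ltn_ord i); move: (_`_i) => w /allpairsP[[x y] /= [xU yU ->]].
have {}xU := vbasis_mem xU; have {}yU := vbasis_mem yU.
rewrite brC br_jacobi rpredN rpredD // br_sub_derived // brC rpredN iU //.
Qed.

Definition killing_mx : 'M[F]_n.+1 :=
  \matrix_(i, j) killing_form (delta_mx 0 i) (delta_mx 0 j).

Lemma mxtrace_ad (B : 'M[F]_n.+1) v :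
  \tr (B *m ad v) = \sum_j v 0 j * \tr (B *m ad (delta_mx 0 j)).
Proof.
rewrite {1}[v]row_sum_delta linear_sum mulmx_sumr raddf_sum /=.
by apply: eq_bigr => i _; rewrite linearZ /= -scalemxAr mxtraceZ.
Qed.

Lemma killing_mxE u v : killing_form u v = (u *m killing_mx *m v^T) 0 0.
Proof.
rewrite mxE /killing_form mxtrace_ad; apply: eq_bigr => j _.
rewrite mulrC !mxE mxtrace_mulC mxtrace_ad; congr (_ * _); apply: eq_bigr => i _.
by rewrite mxE mxtrace_mulC.
Qed.

Lemma killing_mx_unit : (forall x, (forall y, killing_form x y = 0) -> x = 0) ->
  killing_mx \in unitmx.
Proof.
move=> nd; rewrite -row_free_unit -kermx_eq0; apply/rowV0P => v /sub_kermxP v0.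
by apply: nd => y; rewrite killing_mxE v0 mul0mx mxE.
Qed.

Hypothesis nondegenerate : forall x, (forall y, killing_form x y = 0) -> x = 0.

Lemma ad_inj x : ad x = 0 -> x = 0.
Proof.
by move=> x0; apply: nondegenerate => y; rewrite /killing_form x0 mul0mx mxtrace0.
Qed.

(** By nondegeneracy some [w] represents the linear form [v |-> \tr (N *m ad v)]. The difference
    [E = ad w - N] is then a derivation with zero trace against every [ad v], and cyclicity of the
    trace turns [killing_form (u *m E) v] into [\tr (E *m ad (br u v)) = 0]. *)
Lemma derivation_inner N : (forall u, ad (u *m N) = ad u *m N - N *m ad u) ->
  exists w, ad w = N.
Proof.
move=> dN; have Gu := killing_mx_unit nondegenerate.
pose t : V := \row_j \tr (N *m ad (delta_mx 0 j)).
exists (t *m invmx killing_mx); set w : V := _ *m _.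
have trw v : \tr (ad w *m ad v) = \tr (N *m ad v).
  rewrite -/(killing_form w v) killing_mxE [w *m _]mulmxKV // mxtrace_ad mxE.
  by apply: eq_bigr => j _; rewrite !mxE mulrC.
apply/eqP; rewrite -subr_eq0; apply/eqP; set E := _ - _.
suff E0 u : u *m E = 0 by apply/row_matrixP => i; rewrite rowE E0 row0.
have adE : ad (u *m E) = ad u *m E - E *m ad u.
  rewrite /E (mulmxBr u) -[u *m ad w]brE (raddfB ad) /= ad_br dN mulmxBr mulmxBl.
  by rewrite !opprD !opprK addrACA.
apply: nondegenerate => v.
rewrite /killing_form adE mulmxBl (raddfB (@mxtrace _ _)) /= -!mulmxA.
rewrite mxtrace_mulC -mulmxA -(raddfB (@mxtrace _ _)) -mulmxBr -ad_br.
rewrite /E mulmxBl (raddfB (@mxtrace _ _)) /= trw.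
by rewrite subrr.
Qed.

End LieAlgebra.

Lemma mx_complexE (R : rcfType) m n (M : 'M[R[i]]_(m, n)) :
  M = map_mx (real_complex R) (map_mx (@complex.Re R) M) +
      'i%C *: map_mx (real_complex R) (map_mx (@complex.Im R) M).
Proof. by apply/matrixP => i j; rewrite !mxE; exact: complexE. Qed.

Lemma complex_eq0 (R : rcfType) (a b : R) :
  real_complex R a + 'i%C * real_complex R b = 0 -> a = 0 /\ b = 0.
Proof. by simpc; case. Qed.

Lemma mx_complex_eq0 (R : rcfType) m n (A B : 'M[R]_(m, n)) :
  map_mx (real_complex R) A + 'i%C *: map_mx (real_complex R) B = 0 ->
  A = 0 /\ B = 0.
Proof.
move=> /matrixP AB0.
have E i j : A i j = 0 /\ B i j = 0.
  by apply: complex_eq0; have := AB0 i j; rewrite !mxE.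
by split; apply/matrixP => i j; rewrite mxE; case: (E i j).
Qed.

Lemma mx_Re_Im_eq0 (R : rcfType) m n (M : 'M[R[i]]_(m, n)) :
  map_mx (@complex.Re R) M = 0 -> map_mx (@complex.Im R) M = 0 -> M = 0.
Proof.
move=> /matrixP re0 /matrixP im0; apply/matrixP => i j; apply/eqP.
by rewrite mxE eq_complex; have := re0 i j; have := im0 i j;
  rewrite !mxE => -> ->; rewrite !eqxx.
Qed.

(** * Cartan's criterion over a real closed field *)

Section RealLieAlgebra.
Variables (R : rcfType) (n : nat).
Local Notation V := 'rV[R]_n.+1.
Local Notation C := R[i].
Local Notation cmx := (map_mx (real_complex R)).
Variable ad : {linear V -> 'M[R]_n.+1}.
Variable br : V -> V -> V.
Hypothesis brE : forall u v, br u v = v *m ad u.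
Hypothesis br_xx : forall u, br u u = 0.
Hypothesis ad_br : forall u v, ad (br u v) = ad v *m ad u - ad u *m ad v.
Implicit Types (u v w x y z : V) (M P U : {vspace V}).

Local Notation killing := (killing_form ad).
Local Notation derived := (derived_algebra br).

Definition complex_ad (u : 'rV[C]_n.+1) : 'M[C]_n.+1 :=
  \sum_i u 0 i *: cmx (ad (delta_mx 0 i)).

Lemma complex_ad_is_linear : linear complex_ad.
Proof.
move=> a u v; rewrite /complex_ad scaler_sumr -big_split /=.
by apply: eq_bigr => i _; rewrite !mxE scalerDl scalerA.
Qed.

HB.instance Definition _ :=
  GRing.isLinear.Build C _ _ _ complex_ad complex_ad_is_linear.

Lemma complex_ad_map u : complex_ad (cmx u) = cmx (ad u).
Proof.
rewrite {2}[u]row_sum_delta linear_sum map_mx_sum; apply: eq_bigr => i _.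
by rewrite linearZ /= map_mxZ mxE.
Qed.

Lemma derivation_complex_ad x : derivation_mx complex_ad (cmx (ad x)).
Proof.
apply: derivation_mx_delta => i /=.
rewrite -(map_delta_mx (real_complex R)) -map_mxM -[_ *m ad x]brE !complex_ad_map.
by rewrite ad_br map_mxB !map_mxM.
Qed.

Lemma mxtrace_complex_ad (B : 'M[C]_n.+1) (v : 'rV[C]_n.+1) :
  \tr (B *m complex_ad v) = \sum_j v 0 j * \tr (B *m cmx (ad (delta_mx 0 j))).
Proof.
rewrite mulmx_sumr raddf_sum /=.
by apply: eq_bigr => i _; rewrite -scalemxAr mxtraceZ.
Qed.

Lemma mxtrace_cmx_ad u v :
  \tr (cmx (ad u) *m cmx (ad v)) = real_complex R (killing u v).
Proof.
rewrite -map_mxM /killing_form /mxtrace raddf_sum.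
by apply: eq_bigr => i _; rewrite mxE.
Qed.

(** The radical [K] of the Killing form is an ideal, so it is enough to see that it is solvable. Its
    derived series stabilizes at a perfect ideal [P]; Cartan's criterion makes [ad y] nilpotent for
    every [y] in [P], and Engel's theorem gives [P = 0]. *)
Lemma killing_nondegenerate :
  (forall U, (forall u v, v \in U -> br u v \in U) ->
    (exists k, iter k derived U = 0%VS) -> U = 0%VS) ->
  forall x, (forall y, killing x y = 0) -> x = 0.
Proof.
move=> ss x x0.
pose K : {vspace V} := lker (linfun (mulmxr (killing_mx ad))).
have KP u : reflect (forall v, killing u v = 0) (u \in K).
  rewrite memv_ker lfunE /=; apply: (iffP eqP) => [u0 v|u0].
    by rewrite killing_mxE u0 mul0mx mxE.
  apply/rowP => j; have := u0 (delta_mx 0 j).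
  by rewrite killing_mxE trmx_delta -colE mxE => ->; rewrite mxE.
suff K0 : K = 0%VS by apply/eqP; rewrite -memv0 -K0; apply/KP.
have iK u v : u \in K -> br u v \in K.
  move=> /KP uK; apply/KP => w.
  rewrite (brC brE br_xx) killing_formNl (killing_form_br ad_br).
  by rewrite uK !oppr0.
have iter_le k : (iter k derived K <= K)%VS.
  elim: k => //= k IHk; apply: derived_sub => u v uk _.
  by apply: iK; apply: (subvP IHk).
have iter_ideal k u v : u \in iter k derived K -> br u v \in iter k derived K.
  elim: k u v => [|k IHk] u v /=; first exact: iK.
  by apply: (derived_ideal brE br_xx ad_br).
have derived_le k : (iter k.+1 derived K <= iter k derived K)%VS.
  by apply: derived_sub => u v uk _; apply: iter_ideal.
have [k Ek] : exists k, iter k.+1 derived K = iter k derived K.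
  apply: contrapT => /forallNP nE.
  have lt k : (\dim (iter k derived K) + k <= \dim K)%N.
    elim: k => [|k IHk]; first by rewrite addn0.
    apply: leq_trans IHk; rewrite addnS ltn_add2r ltnNge; apply/negP => le.
    by apply: (nE k); apply/eqP; rewrite eqEdim derived_le.
  by have := lt (\dim K).+1; rewrite addnS ltnNge leq_addl.
set P := iter k derived K in Ek.
have nilP : nil_algebra ad P.
  move=> y yP; exists n.+1.
  have yd : y \in derived P by rewrite /P -iterS Ek.
  suff : cmx (ad y ^+ n.+1) = 0 by move/eqP; rewrite map_mx_eq0 => /eqP.
  rewrite rmorphXn /=.
  apply: (derivation_trace_nilpotent (derivation_complex_ad y)) => D dD.
  move: yd => /(@coord_span _ _ _ (in_tuple _)) ->.
  rewrite linear_sum map_mx_sum mulmx_suml raddf_sum big1 //= => i _.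
  rewrite linearZ /= map_mxZ -scalemxAl mxtraceZ.
  have := mem_nth 0 (ltn_ord i); move: (_`_i) => w /allpairsP[[a b] /= [aP _ ->]].
  (* As [D] is a derivation, this is minus the trace of [ad a] against [ad] of the complex vector
     [b D]. It vanishes because [a], being in the radical, is orthogonal also to complex
     combinations of real vectors. *)
  suff -> : \tr (cmx (ad (br a b)) *m D) = 0 by rewrite mulr0.
  have {}aP : a \in K by apply: (subvP (iter_le k)); apply: vbasis_mem.
  rewrite ad_br map_mxB !map_mxM mulmxBl (raddfB (@mxtrace _ _)) /= -!mulmxA mxtrace_mulC.
  rewrite -mulmxA -raddfB -mulmxBr -[D *m _ - _]opprB -(complex_ad_map b).
  rewrite -dD mulmxN raddfN /= mxtrace_complex_ad big1 ?oppr0 // => j _.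
  by rewrite mxtrace_cmx_ad (KP _ aP) raddf0 mulr0.
apply: ss; first by move=> u v vK; rewrite (brC brE br_xx) rpredN iK.
exists k; apply: (perfect_nil_algebra brE br_xx ad_br) nilP _.
  by move=> u v _ vP; rewrite (brC brE br_xx) rpredN iter_ideal.
by move: Ek; rewrite iterS -/P => ->.
Qed.

Hypothesis nondegenerate : forall x, (forall y, killing x y = 0) -> x = 0.

(** Complexification keeps the Gram matrix, and a real invertible matrix stays invertible over
    [R[i]]. *)
Lemma complex_killing_nondegenerate (W : 'rV[C]_n.+1) :
  (forall v : 'rV[C]_n.+1, killing_form complex_ad W v = 0) -> W = 0.
Proof.
move=> W0; have Gu : cmx (killing_mx ad) \in unitmx.
  by rewrite map_unitmx killing_mx_unit.
apply: (can_inj (mulmxK Gu)); rewrite mul0mx; apply/rowP => j.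
have := W0 (cmx (delta_mx 0 j)).
rewrite killing_formC /killing_form /= complex_ad_map mxtrace_complex_ad => E.
rewrite mxE [RHS]mxE -[RHS]E; apply: eq_bigr => i _.
by rewrite mxtrace_cmx_ad !mxE killing_formC.
Qed.

Lemma derivation_mx_complex_ad W : derivation_mx complex_ad (complex_ad W).
Proof.
rewrite {2}/complex_ad; apply: big_ind => [u|D1 D2 d1 d2|i _].
- by rewrite mulmx0 linear0 mulmx0 mul0mx subrr.
- by rewrite -[D1]scale1r; apply: derivation_mx_linear.
rewrite -[_ *: _]addr0; apply: derivation_mx_linear.
  exact: derivation_complex_ad.
by move=> u; rewrite mulmx0 linear0 mulmx0 mul0mx subrr.
Qed.

Lemma mxtrace_complex_ad_cmx (W : 'rV[C]_n.+1) z :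
  \tr (complex_ad W *m cmx (ad z)) =
  real_complex R (killing (map_mx (@complex.Re R) W) z) +
  'i%C * real_complex R (killing (map_mx (@complex.Im R) W) z).
Proof.
rewrite mxtrace_mulC mxtrace_complex_ad !(killing_formC _ _ z) /killing_form.
rewrite !(mxtrace_ad ad (ad z)) !raddf_sum mulr_sumr -big_split /=.
apply: eq_bigr => j _; rewrite mxtrace_cmx_ad {1}[W 0 j]complexE mulrDl -mulrA.
by rewrite !mxE !rmorphM.
Qed.

(* The nilpotent part of [ad X] is the inner derivation of the returned [W]. *)
Lemma exists_nilpotent_part X : exists W : 'rV[C]_n.+1,
  [/\ W = 0 -> diagonalizable (cmx (ad X)), W *m cmx (ad X) = 0,
      forall s : 'M[R]_n.+1, s *m s = 1%:M ->
        (forall u, ad (u *m s) = s *m ad u *m s) ->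
        X *m s = - X -> W *m cmx s = - W &
      forall z, br X z = 0 -> \tr (complex_ad W *m cmx (ad z)) = 0].
Proof.
have dX := derivation_complex_ad X.
have [p [dS diagS nilN Sodd]] := derivation_jordan dX.
set A := cmx (ad X) in dX p dS diagS nilN Sodd *.
set S := horner_mx A p in dS diagS nilN Sodd.
have [|W WE] := @derivation_inner _ _ complex_ad (fun a b => b *m complex_ad a)
  (fun _ _ => erefl) derivation_mx_complex_ad
  complex_killing_nondegenerate (A - S).
  exact: derivation_mxB.
exists W; split.
- move=> W0; move: WE; rewrite W0 raddf0 => /esym/eqP.
  by rewrite subr_eq0 => /eqP ->.
- apply: (ad_inj complex_killing_nondegenerate); rewrite (dX W) /= WE.
  suff -> : (A - S) *m A = A *m (A - S) by rewrite subrr.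
  by rewrite mulmxBl mulmxBr; congr (_ - _); apply/esym/comm_mx_horner.
(* Conjugation by [s] changes the sign of both [A] and [S], hence of [complex_ad W]; injectivity of
   [complex_ad] transfers this to [W]. *)
- move=> s ss sad Xs; apply/eqP; rewrite -addr_eq0; apply/eqP.
  apply: (ad_inj complex_killing_nondegenerate); rewrite raddfD /= WE.
  have sA : cmx s *m A *m cmx s = - A.
    by rewrite -!map_mxM -sad Xs (raddfN ad) map_mxN.
  have -> : complex_ad (W *m cmx s) = cmx s *m complex_ad W *m cmx s.
    apply: ad_intertwine_delta => i /=.
    rewrite -(map_delta_mx (real_complex R)) -map_mxM !complex_ad_map sad.
    by rewrite !map_mxM.
  rewrite WE mulmxBr mulmxBl sA Sodd // -?map_mxM ?ss ?map_mx1 //.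
  by rewrite opprK addrACA addNr addrN addr0.
move=> z Xz0.
(* [ad z] commutes with [ad X], hence with the nilpotent polynomial [A - S] in it, and the product
   of the two is nilpotent. *)
rewrite WE; apply: (@mxtrace_nilpotent _ _ _ n.+1).
have AB : GRing.comm A (cmx (ad z)).
  rewrite /GRing.comm -!mulmxE -!map_mxM; congr cmx; apply/eqP.
  by rewrite eq_sym -subr_eq0 -ad_br Xz0 raddf0.
have NB : GRing.comm (A - S) (cmx (ad z)).
  by apply/comm_mx_sym/comm_mxB; [|apply: comm_mx_horner]; apply/comm_mx_sym.
by rewrite mulmxE exprMn_comm // nilN mul0r.
Qed.

End RealLieAlgebra.

Lemma diagonalizable_ker2 (F : fieldType) n (A : 'M[F]_n) (v : 'rV_n) :
  diagonalizable A -> v *m A *m A = 0 -> v *m A = 0.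
Proof.
move=> [P Pu /diagonalizable_forPex[d /(simmxP Pu) PA]] vAA.
have PVA : invmx P *m diag_mx d = A *m invmx P.
  by apply: (can_inj (mulKmx Pu)); rewrite !mulmxA mulmxV // mul1mx PA mulmxK.
apply: (can_inj (mulmxK (_ : invmx P \in unitmx))); first by rewrite unitmx_inv.
rewrite -mulmxA -PVA mul0mx mulmxA; apply/rowP => i.
have : v *m A *m A *m invmx P = 0 by rewrite vAA mul0mx.
rewrite -mulmxA -PVA mulmxA -[v *m A *m _]mulmxA -PVA mulmxA.
move/rowP/(_ i); rewrite !mul_mx_diag !mxE => /eqP; rewrite mulf_eq0.
by case/orP => [/eqP -> //|/eqP ->]; rewrite mulr0.
Qed.

(** * Symmetric Lie algebras *)

Section SymmetricLieAlgebra.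
Variables (R : rcfType) (n : nat).
Local Notation V := 'rV[R]_n.+1.
Local Notation cmx := (map_mx (real_complex R)).
Variable ad : {linear V -> 'M[R]_n.+1}.
Variable br : V -> V -> V.
Hypothesis brE : forall u v, br u v = v *m ad u.
Hypothesis br_xx : forall u, br u u = 0.
Hypothesis ad_br : forall u v, ad (br u v) = ad v *m ad u - ad u *m ad v.
Implicit Types (u v w x y z : V).
Local Notation killing := (killing_form ad).
Hypothesis nondegenerate : forall x, (forall y, killing x y = 0) -> x = 0.
Variable s : 'M[R]_n.+1.
Hypothesis ss : s *m s = 1%:M.
Hypothesis s_br : forall u v, br u v *m s = br (u *m s) (v *m s).

Lemma ad_involution u : ad (u *m s) = s *m ad u *m s.
Proof.
apply/row_matrixP => i; rewrite !rowE -brE.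
have := s_br u (delta_mx 0 i *m s).
by rewrite -!mulmxA ss mulmx1 => <-; rewrite brE !mulmxA.
Qed.

Lemma killing_involution u v : killing (u *m s) (v *m s) = killing u v.
Proof.
rewrite /killing_form !ad_involution -!mulmxA (mulmxA s s) ss mul1mx.
by rewrite mxtrace_mulC -!mulmxA ss mulmx1.
Qed.

Variable X : V.
Hypothesis Xs : X *m s = - X.

(* As [B] is nondegenerate on h, the orthogonal of [h, X] in q is the
   centralizer of [X] in q. *)
Lemma orthogonal_tangent z : z *m s = - z ->
  (forall a, a *m s = a -> killing z (br a X) = 0) -> br X z = 0.
Proof.
move=> zs zX; apply: nondegenerate => y.
have bs : br X z *m s = br X z.
  by rewrite s_br Xs zs brE mulNmx (raddfN ad) mulmxN opprK -brE.
(* [br X z] lies in h, so it pairs only with the h-component of [y], which is half of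
   [y + y *m s]. *)
have E : killing (y + y *m s) (br X z) = killing y (br X z) *+ 2.
  by rewrite killing_formDl -{2}bs killing_involution.
suff : killing (y + y *m s) (br X z) = 0.
  rewrite E killing_formC => /eqP.
  by rewrite mulrn_eq0 /= => /eqP.
have ays : (y + y *m s) *m s = y + y *m s.
  by rewrite mulmxDl -mulmxA ss mulmx1 addrC.
rewrite killing_formC (killing_form_br ad_br) (brC brE br_xx).
by rewrite killing_formC killing_formNl opprK killing_formC zX.
Qed.

Lemma br_tangent a : a *m s = a -> br a X *m s = - br a X.
Proof. by move=> sa; rewrite s_br sa Xs brE mulNmx -brE. Qed.

Lemma diagonalizable_tangent : diagonalizable (cmx (ad X)) ->
  forall a, a *m s = a ->
    (forall b, b *m s = b -> killing (br a X) (br b X) = 0) -> br a X = 0.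
Proof.
move=> diagX a sa aX; have := orthogonal_tangent (br_tangent sa) aX.
rewrite (brC brE br_xx a) brE brE mulNmx => /eqP; rewrite oppr_eq0 => /eqP aXX.
suff : cmx (a *m ad X) = 0 by move/eqP; rewrite map_mx_eq0 => /eqP ->; rewrite oppr0.
rewrite map_mxM; apply: (diagonalizable_ker2 diagX).
by rewrite -!map_mxM aXX map_mx0.
Qed.

(** [h, X] is its own double orthogonal in q, the first orthogonal being written as the centralizer
    of [X] in q. The rows of [T] span [h, X] because [y + y *m s] runs over h. *)
Lemma tangent_biorthogonal w : w *m s = - w ->
  (forall z, z *m s = - z -> br X z = 0 -> killing w z = 0) ->
  exists2 a, a *m s = a & w = br a X.
Proof.
move=> ws wz; pose T := (1%:M + s) *m ad X.
have [/submxP[y Ey]|] := boolP (w <= T)%MS.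
  exists (- (y + y *m s)).
    by rewrite mulNmx mulmxDl -mulmxA ss mulmx1 addrC.
  by rewrite (brC brE br_xx) brE mulNmx opprK Ey mulmxA mulmxDr mulmx1.
rewrite submxE => /eqP wT; case: wT.
have Gu := killing_mx_unit nondegenerate.
apply/rowP => j; rewrite [RHS]mxE.
pose c := col j (cokermx T).
have Tc : T *m c = 0 by rewrite /c colE mulmxA mulmx_coker mul0mx.
(* A column [c] of the cokernel of [T] is a linear form that vanishes on [h, X]; [z0] represents it
   through the Killing form, and [z] below is twice the q-component of [z0]. *)
pose z0 : V := (invmx (killing_mx ad) *m c)^T.
have kz0 u : killing u z0 = (u *m c) 0 0.
  by rewrite killing_mxE trmxK -mulmxA mulKVmx.
pose z := z0 - z0 *m s.
have zs : z *m s = - z by rewrite mulmxBl -mulmxA ss mulmx1 opprB.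
have kz u : u *m s = - u -> killing u z = killing u z0 *+ 2.
  move=> us; have := killing_involution u (z0 *m s).
  rewrite us -mulmxA ss mulmx1 killing_formNl => E.
  rewrite /z killing_formC killing_formDl killing_formNl.
  by rewrite -!(killing_formC ad u) -E opprK.
have : killing w z = 0.
  apply: wz => //; apply: orthogonal_tangent => // a sa.
  rewrite killing_formC kz ?br_tangent // kz0 (brC brE br_xx) brE.
  have -> : a = (2%:R^-1 *: a) *m (1%:M + s).
    by rewrite mulmxDr mulmx1 -scalemxAl sa -scalerDl -[_^-1]mul1r -splitr scale1r.
  by rewrite mulNmx -!mulmxA (mulmxA _ (ad X)) Tc mulmx0 oppr0 mxE mul0rn.
rewrite kz // kz0 => /eqP; rewrite mulrn_eq0 /= => /eqP wc; apply: etrans wc.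
have -> : w *m c = col j (w *m cokermx T) by rewrite /c !colE mulmxA.
by rewrite [RHS]mxE.
Qed.

Lemma tangent_diagonalizable :
  (forall a, a *m s = a ->
    (forall b, b *m s = b -> killing (br a X) (br b X) = 0) -> br a X = 0) ->
  diagonalizable (cmx (ad X)).
Proof.
move=> ndX.
have w0 w : w *m s = - w -> br X w = 0 ->
    (forall z, z *m s = - z -> br X z = 0 -> killing w z = 0) -> w = 0.
  move=> ws Xw wz; have [a sa Ew] := tangent_biorthogonal ws wz.
  (* [w] lies in [h, X] and, as [br X w = 0], invariance of the form makes it orthogonal to
     [h, X]. *)
  rewrite Ew; apply: ndX => // b sb.
  rewrite -Ew (brC brE br_xx) killing_formC killing_formNl (killing_form_br ad_br).
  by rewrite Xw killing_formC /killing_form raddf0 mul0mx mxtrace0 !oppr0.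
have [W [diagW WX Ws Wz]] := exists_nilpotent_part brE ad_br nondegenerate X.
apply: diagW; have {}Ws := Ws s ss ad_involution Xs.
pose w1 := map_mx (@complex.Re R) W; pose w2 := map_mx (@complex.Im R) W.
have EW : W = cmx w1 + 'i%C *: cmx w2 := mx_complexE W.
have [w1X w2X] : w1 *m ad X = 0 /\ w2 *m ad X = 0.
  apply: mx_complex_eq0; rewrite !map_mxM; apply: etrans WX.
  by rewrite EW mulmxDl scalemxAl.
have [w1s w2s] : w1 *m s + w1 = 0 /\ w2 *m s + w2 = 0.
  apply: mx_complex_eq0; rewrite !map_mxD !map_mxM.
  move/eqP: Ws; rewrite -addr_eq0 => /eqP <-; rewrite EW mulmxDl -scalemxAl.
  by rewrite scalerDr addrACA.
have wz z : br X z = 0 -> killing w1 z = 0 /\ killing w2 z = 0.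
  by move=> /Wz; rewrite mxtrace_complex_ad_cmx => /complex_eq0.
apply: mx_Re_Im_eq0; apply: w0; rewrite ?brE //.
- by apply/eqP; rewrite -addr_eq0 w1s.
- by move=> z _ /wz[].
- by apply/eqP; rewrite -addr_eq0 w2s.
- by move=> z _ /wz[].
Qed.

End SymmetricLieAlgebra.

(** * Symmetry of second derivatives *)

Section DirectionalDerivatives.
Variable R : realType.
Implicit Types U V W : normedModType R.

Lemma near_eq_diff V W (f g : V -> W) p : {near p, f =1 g} ->
  differentiable f p -> differentiable g p /\ 'd g p = 'd f p :> (V -> W).
Proof.
move=> fg df; have fgp : f p = g p := nbhs_singleton fg.
have gE : g \o shift p = cst (g p) + 'd f p +o_ 0 id.
  apply/eqaddoP => e e0.
  have fg0 : \forall h \near 0, f (h + p) = g (h + p).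
    by have : \forall x \near p, f x = g x := fg; rewrite (near_shift 0 p) subr0.
  have /eqaddoP/(_ e e0) := diff_locally df; apply: filterS2 fg0 => h fgh.
  by rewrite !fctE /= -fgh -fgp.
have dg := diff_unique (diff_continuous df) gE.
split; last exact: dg.
by apply/diff_locallyP; rewrite dg; split; [exact: diff_continuous|exact: gE].
Qed.

Lemma near_eq_differentiable V W (f g : V -> W) p : {near p, f =1 g} ->
  differentiable f p -> differentiable g p.
Proof. by move=> fg /(near_eq_diff fg)[]. Qed.

Lemma differentiable_near_le V W (f : V -> W) p e : 0 < e ->
  differentiable f p ->
  \forall h \near 0, `|f (p + h) - f p - 'D_h f p| <= e * `|h|.
Proof.
move=> e0 df; have /eqaddoP/(_ e e0) := diff_locally df.
apply: filterS => h; rewrite !fctE /= opprD addrA [h + p]addrC (deriveE _ df).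
by [].
Qed.

Lemma derive_comp U V W (f : U -> V) (g : V -> W) p v :
  differentiable f p -> differentiable g (f p) ->
  'D_v (g \o f) p = 'D_('D_v f p) g (f p).
Proof.
move=> df dg; have dgf := differentiable_comp df dg.
by rewrite (deriveE _ dgf) (deriveE _ df) (deriveE _ dg) (diff_comp df dg).
Qed.

Lemma derive_linearP V W (f : V -> W) p a u v : differentiable f p ->
  'D_(a *: u + v) f p = a *: 'D_u f p + 'D_v f p.
Proof. by move=> df; rewrite !(deriveE _ df) linearP. Qed.

Lemma derive_lin V W (f : {linear V -> W}) p v : continuous f -> 'D_v f p = f v.
Proof. by move=> fc; rewrite (deriveE _ (linear_differentiable p fc)) (diff_lin p fc). Qed.

Lemma differentiable_scale V W (k : V -> R) (h : V -> W) p :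
  differentiable k p -> differentiable h p ->
  differentiable (fun x => k x *: h x) p /\
  forall v, 'D_v (fun x => k x *: h x) p = k p *: 'D_v h p + 'D_v k p *: h p.
Proof.
move=> dk dh.
have bil : bilinear_for (GRing.Scale.Law.clone _ _ *:%R _)
    (GRing.Scale.Law.clone _ _ *:%R _) (fun (a : R^o) (w : W) => a *: w).
  split=> [w|c] a x y /=; first by rewrite scalerDl scalerA.
  by rewrite scalerDr !scalerA mulrC.
pose bM := bilinear_isBilinear.Build _ _ _ _ _ _ _ bil.
pose b : {bilinear R^o -> W -> W} := HB.pack (fun (a : R^o) (w : W) => a *: w) bM.
have bc : continuous (fun z : R^o * W => b z.1 z.2) by exact: scale_continuous.
have E : (fun x => k x *: h x) = (fun z : R^o * W => b z.1 z.2) \o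
   (fun x => (k x : R^o, h x)) by [].
have dp : differentiable (fun x => (k x : R^o, h x)) p by exact: differentiable_pair.
have db := differentiable_bilin (k p, h p) bc.
have dE : differentiable (fun x => k x *: h x) p.
  by rewrite E; apply: differentiable_comp dp db.
split=> [|v]; first exact: dE.
rewrite (deriveE _ dE) (deriveE _ dk) (deriveE _ dh) E.
transitivity ('d (fun z : R^o * W => b z.1 z.2) (k p, h p)
    ('d (fun x => (k x : R^o, h x)) p v)).
  exact: (congr1 (fun F : V -> W => F v) (diff_comp dp db)).
rewrite (congr1 (fun F : V -> R^o * W => F v) (diff_pair dk dh)).
exact: (congr1 (fun F : R^o * W -> W => F _) (diff_bilin (k p, h p) bc)).
Qed.

End DirectionalDerivatives.

Section TwiceDifferentiable.
Variable R : realType.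
Implicit Types U V W : normedModType R.

(** The first derivatives are differentiable at [p] itself only. This is the hypothesis of Young's
    theorem on mixed derivatives, and it passes to composites. *)
Definition twice_differentiable V W (f : V -> W) p :=
  (\forall x \near p, differentiable f x) /\
  forall v, differentiable ('D_v f) p.

Lemma line_derive V (p u : V) (t : R) :
  differentiable (fun t : R => p + t *: u) t /\
  'D_1 (fun t : R => p + t *: u) t = u.
Proof.
have [ds Ds] := differentiable_scale (@ex_diff _ _ _ _ _ _ _ (is_diff_id (t : R)))
   (differentiable_cst u (t : R)).
have -> : (fun t : R => p + t *: u) = cst p + (fun t : R => t *: u) by [].
split; first by apply: differentiableD => //; exact: differentiable_cst.
rewrite deriveD; [|exact: derivable_cst|exact: diff_derivable].
by rewrite derive_cst add0r (Ds 1) derive_cst scaler0 add0r derive_id scale1r.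
Qed.

(** The mean value theorem along [u] is applied to the difference of [f] over two parallel segments
    [s *: v] apart; then ['D_u f] is expanded to first order at [p]. The two expansions contribute
    |u| twice and |v| once to the error. *)
Lemma second_difference V (f : V -> R) p u v e : 0 < e ->
  (\forall x \near p, differentiable f x) -> differentiable ('D_u f) p ->
  exists2 d, 0 < d & forall s, 0 < s -> s < d ->
   `|f (p + s *: u + s *: v) - f (p + s *: u) - f (p + s *: v) + f p
      - s ^+ 2 * 'D_v ('D_u f) p| <= e * s ^+ 2 * (`|u| *+ 2 + `|v|).
Proof.
move=> e0 /nbhs_normP[d1 /= d10 fd] dg.
have /nbhs_norm0P[d2 /= d20 gd] := differentiable_near_le e0 dg.
(* Keeps every [t *: u + t' *: v] with [t] and [t'] between 0 and [s] within both radii; the summand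
   1 guards against [u = v = 0]. *)
pose d := Num.min d1 d2 / (`|u| + `|v| + 1).
have uv0 : 0 < `|u| + `|v| + 1 by rewrite ltr_wpDl // addr_ge0.
exists d; first by rewrite divr_gt0 // lt_min d10 d20.
move=> s s0; rewrite /d ltr_pdivlMr // => sd.
have small t t' : 0 <= t <= s -> 0 <= t' <= s ->
    `|t *: u + t' *: v| < Num.min d1 d2.
  move=> /andP[t0 ts] /andP[t'0 t's]; apply: le_lt_trans sd.
  rewrite (le_trans (ler_normD _ _)) // !normrZ !ger0_norm // !mulrDr mulr1.
  by rewrite (le_trans (lerD (ler_wpM2r _ ts) (ler_wpM2r _ t's))) // lerDl ltW.
have Df t t' : 0 <= t <= s -> 0 <= t' <= s ->
    differentiable f (p + t' *: v + t *: u).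
  move=> ht ht'; rewrite -addrA [_ *: v + _]addrC.
  apply: fd; rewrite /ball_ /= opprD addNKr normrN.
  by have := small _ _ ht ht'; rewrite lt_min => /andP[].
pose h t := f (p + s *: v + t *: u) - f (p + 0 *: v + t *: u).
pose dh t := 'D_u f (p + s *: v + t *: u) - 'D_u f (p + 0 *: v + t *: u).
have s0s : 0 <= s <= s by apply/andP; split; [exact: ltW|].
have s00 : 0 <= (0 : R) <= s by apply/andP; split; [|exact: ltW].
have Dh (t : R) : 0 <= t <= s -> differentiable (h : R -> R) t /\ 'D_1 h t = dh t.
  move=> ht; have [dl1 Dl1] := line_derive (p + s *: v) u t.
  have [dl2 Dl2] := line_derive (p + 0 *: v) u t.
  have df1 := Df _ _ ht s0s; have df2 := Df _ _ ht s00.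
  have c1 := differentiable_comp dl1 df1.
  have c2 := differentiable_comp dl2 df2.
  split; first exact: (differentiableB c1 c2).
  transitivity ('D_1 (f \o (fun t : R => p + s *: v + t *: u)) t
              - 'D_1 (f \o (fun t : R => p + 0 *: v + t *: u)) t).
    by apply: deriveB; exact: diff_derivable.
  by rewrite (derive_comp _ dl1 df1) (derive_comp _ dl2 df2) Dl1 Dl2.
have [||c cs Eh] := @MVT R h dh 0 s s0.
- move=> x; rewrite in_itv /= => /andP[x0 xs].
  have [|d' <-] := Dh x; first by rewrite !ltW.
  by apply: DeriveDef => //; exact: diff_derivable.
- apply: continuous_in_subspaceT => x; rewrite inE /= in_itv /= => xs.
  by have [/differentiable_continuous] := Dh x xs.
have c0s : 0 <= c <= s by move: cs; rewrite in_itv /= => /andP[/ltW -> /ltW ->].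
pose k1 := c *: u + s *: v; pose k2 := c *: u + 0 *: v.
have bound t : 0 <= t <= s ->
    `|'D_u f (p + (c *: u + t *: v)) - 'D_u f p - 'D_(c *: u + t *: v) ('D_u f) p|
    <= e * (s * `|u| + t * `|v|).
  move=> ht; apply: le_trans (gd _ _) _.
    by have := small _ _ c0s ht; rewrite lt_min /= => /andP[].
  rewrite ler_pM2l // (le_trans (ler_normD _ _)) // !normrZ.
  case/andP: c0s => ? ?; case/andP: ht => ? ?.
  by rewrite !ger0_norm // lerD2r ler_wpM2r.
have D1 : 'D_k1 ('D_u f) p - 'D_k2 ('D_u f) p = s * 'D_v ('D_u f) p.
  rewrite /k1 /k2 scale0r addr0 !(deriveE _ dg) linearD addrAC subrr add0r.
  by rewrite linearZ.
have -> : f (p + s *: u + s *: v) - f (p + s *: u) - f (p + s *: v) + f p =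
    s * dh c.
  rewrite mulrC -[s in _ * s]subr0 -Eh /h !scale0r !addr0.
  rewrite [p + s *: u + _]addrAC.
  by rewrite opprB [f p - _]addrC addrA.
rewrite expr2 -[s * s * _]mulrA -mulrBr normrM (gtr0_norm s0).
rewrite [e * _]mulrCA -!mulrA ler_pM2l //.
have -> : dh c - s * 'D_v ('D_u f) p =
   ('D_u f (p + k1) - 'D_u f p - 'D_k1 ('D_u f) p) -
   ('D_u f (p + k2) - 'D_u f p - 'D_k2 ('D_u f) p).
  have Ek t : p + (c *: u + t *: v) = p + t *: v + c *: u by rewrite addrA addrAC.
  have alg (a b g a' b' : R) : a - b - (a' - b') = a - g - a' - (b - g - b').
    by ring.
  by rewrite -D1 /dh !Ek; exact: alg.
rewrite (le_trans (ler_normB _ _)) // (le_trans (lerD (bound _ s0s) (bound _ s00))) //.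
by rewrite mul0r addr0 -mulrDr ler_pM2l // mulr2n !mulrDr addrAC.
Qed.

(** The second difference is symmetric in [u] and [v], and divided by [s ^+ 2] it is close to either
    mixed derivative. *)
Lemma schwarz V (f : V -> R) p u v : twice_differentiable f p ->
  'D_v ('D_u f) p = 'D_u ('D_v f) p.
Proof.
move=> [fd gd]; apply/eqP; rewrite -subr_eq0 -normr_le0; apply/ler_addgt0Pr => e e0.
rewrite add0r.
(* Sum of the two error factors, plus 1 to make it positive. *)
pose K := `|u| *+ 2 + `|v| + (`|v| *+ 2 + `|u|) + 1.
have K0 : 0 < K by rewrite ltr_wpDl // !addr_ge0 // mulrn_wge0.
have eK : 0 < e / K by rewrite divr_gt0.
have [d1 d10 H1] := second_difference v eK fd (gd u).
have [d2 d20 H2] := second_difference u eK fd (gd v).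
pose s := Num.min d1 d2 / 2.
have d12 : 0 < Num.min d1 d2 by rewrite lt_min d10 d20.
have s0 : 0 < s by rewrite divr_gt0.
have sd : s < Num.min d1 d2 by rewrite ltr_pdivrMr // ltr_pMr // ltr1n.
move: (sd); rewrite lt_min => /andP[/(H1 s s0) {}H1 /(H2 s s0) {}H2].
have s20 : 0 < s ^+ 2 by rewrite exprn_gt0.
rewrite -(ler_pM2l s20) -{1}(gtr0_norm s20) -normrM mulrBr.
move: H1 H2; rewrite [p + s *: v + _]addrAC.
move: (f (p + s *: u + s *: v)) (f (p + s *: u)) (f (p + s *: v)) (f p) => A B C D.
move: ('D_v ('D_u f) p) ('D_u ('D_v f) p) => P Q H1 H2.
have -> : s ^+ 2 * P - s ^+ 2 * Q =
  (A - C - B + D - s ^+ 2 * Q) - (A - B - C + D - s ^+ 2 * P) by ring.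
apply: le_trans (ler_normB _ _) (le_trans (lerD H2 H1) _).
rewrite -mulrDr [e / K * _]mulrC -mulrA ler_pM2l //.
apply: le_trans (ler_wpM2l (ltW eK) (_ : _ <= K)) _.
  by rewrite /K [X in X + 1]addrC lerDl.
by rewrite divfK // gt_eqF.
Qed.

End TwiceDifferentiable.

Section DerivativeAlong.
Variable R : realType.
Implicit Types U V W : normedModType R.

Lemma near_comp U V (g : U -> V) q (P : set V) : {for q, continuous g} ->
  (\forall y \near g q, P y) -> \forall x \near q, P (g x).
Proof. by move=> gc; apply: gc. Qed.

Lemma near_near V (p : V) (P : set V) : (\forall x \near p, P x) ->
  \forall x \near p, \forall y \near x, P y.
Proof. by move=> /nbhs_interior. Qed.

Lemma derive_pair U V W (f : U -> V) (g : U -> W) p v :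
  differentiable f p -> differentiable g p ->
  'D_v (fun x => (f x, g x)) p = ('D_v f p, 'D_v g p).
Proof.
move=> df dg; rewrite (deriveE _ (differentiable_pair df dg)).
by rewrite (diff_pair df dg) (deriveE _ df) (deriveE _ dg).
Qed.

Lemma derive_coord V m n (f : V -> 'M[R]_(m, n)) p v i j :
  differentiable f p ->
  differentiable (fun x => f x i j) p /\
  'D_v (fun x => f x i j) p = ('D_v f p) i j.
Proof.
move=> df; split; first exact: differentiable_comp df (differentiable_coord _ _ _).
by rewrite (derive_mx (diff_derivable (v := v) df)) mxE.
Qed.

Lemma schwarz_rV V n (f : V -> 'rV[R]_n) p u v : twice_differentiable f p ->
  'D_v ('D_u f) p = 'D_u ('D_v f) p.
Proof.
move=> [fd gd]; apply/rowP => j.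
have Dj w : {near p, 'D_w (fun x => f x 0 j) =1 (fun x => ('D_w f x) 0 j)}.
  by near=> x; apply: (derive_coord _ _ _ _).2; near: x.
have tj : twice_differentiable (fun x => f x 0 j) p.
  split; first by near=> x; apply: (derive_coord 0 _ _ _).1; near: x.
  move=> w; apply: near_eq_differentiable (derive_coord 0 0 j (gd w)).1.
  by near=> x; rewrite (near (Dj w) x).
have := schwarz u v tj.
rewrite (near_eq_derive _ (Dj u)) (near_eq_derive _ (Dj v)).
by rewrite (derive_coord _ _ _ (gd u)).2 (derive_coord _ _ _ (gd v)).2.
Unshelve. all: by end_near. Qed.

(** A finite generating family with coordinate forms, asked of a source space in order to expand a
    direction that varies with the point. *)
Definition framed V := exists k (e : 'I_k -> V) (c : 'I_k -> V -> R),
  (forall j x v, differentiable (c j) x /\ 'D_v (c j) x = c j v) /\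
  forall v, v = \sum_j c j v *: e j.

Lemma framed_rV n : framed 'rV[R]_n.
Proof.
exists n, (delta_mx 0), (fun j (v : 'rV[R]_n) => v 0 j); split; last exact: row_sum_delta.
move=> j x v; have [d D] := derive_coord v 0 j (@ex_diff _ _ _ _ _ _ _ (is_diff_id x)).
by split=> //; rewrite D derive_id.
Qed.

Lemma differentiable_fst V W (p : V * W) : differentiable fst p /\
  forall v, 'D_v fst p = v.1.
Proof.
have fc : continuous (fst : V * W -> V) by move=> x; exact: cvg_fst.
split; first exact: linear_differentiable.
by move=> v; rewrite derive_lin.
Qed.

Lemma differentiable_snd V W (p : V * W) : differentiable snd p /\
  forall v, 'D_v snd p = v.2.
Proof.
have fc : continuous (snd : V * W -> W) by move=> x; exact: cvg_snd.
split; first exact: linear_differentiable.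
by move=> v; rewrite derive_lin.
Qed.

Lemma framed_prod V W : framed V -> framed W -> framed (V * W)%type.
Proof.
move=> [k [e [c [cd cE]]]] [k' [e' [c' [cd' cE']]]].
exists (k + k')%N.
exists (fun j => match fintype.split j with inl i => (e i, 0) | inr i => (0, e' i) end).
exists (fun j z => match fintype.split j with inl i => c i z.1 | inr i => c' i z.2 end).
split.
  move=> j x v; case: (fintype.split j) => i.
    have [d D] := differentiable_fst x; have [d' D'] := cd i x.1 v.1.
    split; first exact: (differentiable_comp d d').
    by rewrite (derive_comp _ d d') D.
  have [d D] := differentiable_snd x; have [d' D'] := cd' i x.2 v.2.
  split; first exact: (differentiable_comp d d').
  by rewrite (derive_comp _ d d') D.
move=> [v w]; rewrite big_split_ord /=.
under eq_bigr => i _ do rewrite (unsplitK (inl i)) /=.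
under [X in _ + X]eq_bigr => i _ do rewrite (unsplitK (inr i)) /=.
rewrite {1}(cE v) {1}(cE' w).
have -> : \sum_i c i v *: (e i, 0 : W) = (\sum_i c i v *: e i, 0).
  elim/big_rec2 : _ => // i y1 y2 _ ->.
  by congr pair; rewrite /= ?scaler0 ?add0r.
have -> : \sum_i c' i w *: (0 : V, e' i) = (0, \sum_i c' i w *: e' i).
  elim/big_rec2 : _ => // i y1 y2 _ ->.
  by congr pair; rewrite /= ?scaler0 ?add0r.
by congr pair; rewrite /= ?addr0 ?add0r.
Qed.

(** ['D_v f] is known to be differentiable for constant [v] only, so the direction [w x] is expanded
    in the frame. The product rule yields one term for the moving point and one for the moving
    direction. *)
Lemma derive_along U V W (f : V -> W) (g w : U -> V) q : framed V ->
  twice_differentiable f (g q) -> differentiable g q -> differentiable w q ->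
  differentiable (fun x => 'D_(w x) f (g x)) q /\
  forall u, 'D_u (fun x => 'D_(w x) f (g x)) q =
    'D_('D_u g q) ('D_(w q) f) (g q) + 'D_('D_u w q) f (g q).
Proof.
move=> [k [e [c [cd cE]]]] [fd f2] dg dw.
have DE v y : differentiable f y -> 'D_v f y = \sum_j c j v *: 'D_(e j) f y.
  move=> dfy; rewrite (deriveE _ dfy) {1}(cE v) linear_sum.
  by apply: eq_bigr => j _; rewrite linearZ (deriveE _ dfy).
pose F j x := c j (w x) *: 'D_(e j) f (g x).
have dcw j : differentiable (c j \o w) q by apply: differentiable_comp dw (cd _ _ 0).1.
have dfg j : differentiable ('D_(e j) f \o g) q by exact: differentiable_comp.
have FE : {near q, \sum_j F j =1 (fun x => 'D_(w x) f (g x))}.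
  have := near_comp (differentiable_continuous dg) fd; apply: filterS => x dfx.
  by rewrite fct_sumE (DE _ _ dfx).
have dF j := differentiable_scale (dcw j) (dfg j).
have dsF : differentiable (\sum_j F j) q by apply: differentiable_sum => j; exact: (dF j).1.
split; first exact: near_eq_differentiable FE dsF.
move=> u; rewrite -(near_eq_derive _ FE) derive_sum; last first.
  by move=> j; apply: diff_derivable; exact: (dF j).1.
have -> : \sum_j 'D_u (F j) q = \sum_j
    (c j (w q) *: 'D_('D_u g q) ('D_(e j) f) (g q) + c j ('D_u w q) *: 'D_(e j) f (g q)).
  apply: eq_bigr => j _; rewrite (dF j).2 (derive_comp _ dg (f2 _)).
  by rewrite (derive_comp _ dw (cd j _ ('D_u w q)).1) (cd j _ _).2.
rewrite big_split /=; congr (_ + _); last by rewrite -DE //; exact: nbhs_singleton fd.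
have near_D : {near g q, 'D_(w q) f =1 \sum_j (c j (w q) *: 'D_(e j) f)}.
  by apply: filterS fd => y dfy; rewrite fct_sumE (DE _ _ dfy).
rewrite (near_eq_derive _ near_D) derive_sum; last first.
  by move=> j; apply: derivableZ; exact: diff_derivable.
by apply: eq_bigr => j _; rewrite deriveZ //; exact: diff_derivable.
Qed.

Lemma twice_differentiable_comp U V W (f : V -> W) (g : U -> V) q : framed V ->
  twice_differentiable g q -> twice_differentiable f (g q) ->
  twice_differentiable (f \o g) q.
Proof.
move=> frV [gd g2] fq; have [fd f2] := fq.
have dg : differentiable g q := nbhs_singleton gd.
have fgd := near_comp (differentiable_continuous dg) fd.
split; first by near=> x; apply: differentiable_comp; near: x.
move=> v; apply: near_eq_differentiable (derive_along frV fq dg (g2 v)).1.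
by near=> x; rewrite derive_comp //; near: x.
Unshelve. all: by end_near. Qed.

Lemma twice_differentiable_pair U V W (f : U -> V) (g : U -> W) q :
  twice_differentiable f q -> twice_differentiable g q ->
  twice_differentiable (fun x => (f x, g x)) q.
Proof.
move=> [fd f2] [gd g2]; split.
  by near=> x; apply: differentiable_pair; near: x.
move=> v; apply: near_eq_differentiable (differentiable_pair (f2 v) (g2 v)).
by near=> x; rewrite derive_pair //; near: x.
Unshelve. all: by end_near. Qed.

Lemma twice_differentiable_cst V W (w : W) (p : V) :
  twice_differentiable (fun=> w) p.
Proof.
split; first by apply: nearW => x; exact: differentiable_cst.
move=> v; have -> : 'D_v (fun=> w) = cst (0 : W).
  by apply/funext => x; rewrite derive_cst.
exact: differentiable_cst.
Qed.

Lemma twice_differentiable_lin V W (f : {linear V -> W}) (p : V) :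
  continuous f -> twice_differentiable f p.
Proof.
move=> fc; split; first by apply: nearW => x; exact: linear_differentiable.
move=> v; have -> : 'D_v f = cst (f v) by apply/funext => x; rewrite derive_lin.
exact: differentiable_cst.
Qed.

Lemma twice_differentiable_id V (p : V) : twice_differentiable id p.
Proof. by apply: (@twice_differentiable_lin V V idfun) => x; exact: cvg_id. Qed.

Lemma twice_differentiable_fst V W (p : V * W) : twice_differentiable fst p.
Proof. by apply: twice_differentiable_lin => x; exact: cvg_fst. Qed.

Lemma near_eq_twice_differentiable V W (f g : V -> W) p : {near p, f =1 g} ->
  twice_differentiable f p -> twice_differentiable g p.
Proof.
move=> fg [fd f2]; have fgg := near_near fg; split.
  by near=> x; apply: (@near_eq_differentiable _ _ _ f); near: x.
move=> v; apply: near_eq_differentiable (f2 v).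
by near=> x; apply: near_eq_derive; near: x.
Unshelve. all: by end_near. Qed.

End DerivativeAlong.

Lemma class_C_twice_differentiable (R : realType) (V W : normedModType R)
    (U : set V) (f : V -> W) p :
  class_C 2 U f -> (\forall x \near p, U x) -> twice_differentiable f p.
Proof.
move=> [df d2f] Up; split; first exact: filterS Up.
by move=> v; have [d _] := d2f v; apply: d; exact: nbhs_singleton Up.
Qed.

(** * Lie bracket and adjoint representation in the chart at 1 *)

Section LieGroup.
Variables (R : realType) (n : nat) (G : groupTopologicalType).
Variable L : lie_group R n G.
Local Notation E := 'rV[R]_n.

Lemma near_cod (c : chart R n G) x : chart_cod c x ->
  \forall y \near x, chart_cod c y.
Proof. by move=> cx; apply: open_nbhs_nbhs; split=> //; exact: chart_cod_open. Qed.

Lemma near_dom (c : chart R n G) g : chart_dom c g ->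
  \forall y \near g, chart_dom c y.
Proof. by move=> cx; apply: open_nbhs_nbhs; split=> //; exact: chart_dom_open. Qed.

Lemma bwd_cvg (c : chart R n G) x : chart_cod c x ->
  chart_bwd c @ x --> chart_bwd c x.
Proof. by move=> cx; apply: chart_bwd_continuous; exact: mem_set. Qed.

Lemma bwd_fst_cvg (c : chart R n G) x (y : E) : chart_cod c x ->
  (fun z : E * E => chart_bwd c z.1) @ (x, y) --> chart_bwd c x.
Proof. by move=> cx; apply: (cvg_comp _ _ cvg_fst (bwd_cvg cx)). Qed.

Lemma bwd_snd_cvg (c : chart R n G) (x : E) y : chart_cod c y ->
  (fun z : E * E => chart_bwd c z.2) @ (x, y) --> chart_bwd c y.
Proof. by move=> cy; apply: (cvg_comp _ _ cvg_snd (bwd_cvg cy)). Qed.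

Lemma mul_cvg (T : topologicalType) (F : set_system T) (FF : Filter F)
    (f g : T -> G) (x y : G) :
  f @ F --> x -> g @ F --> y -> (fun t => f t * g t)%g @ F --> (x * y)%g.
Proof.
move=> fx gy; have [mulc _] := lie_mul_smooth L.
exact: (cvg_comp _ _ (cvg_pair fx gy) (mulc (x, y))).
Qed.

Lemma inv_cvg (T : topologicalType) (F : set_system T) (FF : Filter F)
    (f : T -> G) (x : G) :
  f @ F --> x -> (fun t => (f t)^-1)%g @ F --> (x^-1)%g.
Proof.
by move=> fx; have [invc _] := lie_inv_smooth L; exact: (cvg_comp _ _ fx (invc x)).
Qed.

Lemma mul_twice_differentiable (c1 c2 d : chart R n G) x y :
  atlas L c1 -> atlas L c2 -> atlas L d -> chart_cod c1 x -> chart_cod c2 y ->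
  chart_dom d (chart_bwd c1 x * chart_bwd c2 y)%g ->
  twice_differentiable
    (fun z : E * E => chart_fwd d (chart_bwd c1 z.1 * chart_bwd c2 z.2)%g) (x, y).
Proof.
move=> Ac1 Ac2 Ad c1x c2y dxy; have [_ mulS] := lie_mul_smooth L.
apply: class_C_twice_differentiable (mulS c1 c2 d Ac1 Ac2 Ad 2%N) _.
have n1 : \forall z \near (x, y), chart_cod c1 z.1 by exact: cvg_fst (near_cod c1x).
have n2 : \forall z \near (x, y), chart_cod c2 z.2 by exact: cvg_snd (near_cod c2y).
have n3 : \forall z \near (x, y), chart_dom d (chart_bwd c1 z.1 * chart_bwd c2 z.2)%g.
  have := mul_cvg _ (bwd_fst_cvg y c1x) (bwd_snd_cvg x c2y).
  by move=> /(_ _ _ (near_dom dxy)); apply.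
by near=> z; split; near: z.
Unshelve. all: by end_near. Qed.

Lemma smooth_map_twice_differentiable (f : G -> G) (c d : chart R n G) x :
  smooth_map (atlas L) f -> atlas L c -> atlas L d -> chart_cod c x ->
  chart_dom d (f (chart_bwd c x)) ->
  twice_differentiable (fun x => chart_fwd d (f (chart_bwd c x))) x.
Proof.
move=> [fc fS] Ac Ad cx dx.
apply: class_C_twice_differentiable (fS c d Ac Ad 2%N) _.
have n1 := near_cod cx.
have n2 : \forall y \near x, chart_dom d (f (chart_bwd c y)).
  exact: (cvg_comp _ _ (bwd_cvg cx) (fc _)) (near_dom dx).
by near=> z; split; near: z.
Unshelve. all: by end_near. Qed.

Local Notation phi := (chart_fwd (chart1 L)).
Local Notation psi := (chart_bwd (chart1 L)).
Local Notation dom := (chart_dom (chart1 L)).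
Local Notation cod := (chart_cod (chart1 L)).
Local Notation a := (phi 1%g).

Lemma cod_a : cod a.
Proof. by apply: chart_fwd_cod; exact: chart1_dom. Qed.

Lemma psi_a : psi a = 1%g.
Proof. by apply: chart_fwdK; exact: chart1_dom. Qed.

Lemma psi_cvg1 : psi @ a --> (1 : G)%g.
Proof. by rewrite -{2}psi_a; apply: bwd_cvg; exact: cod_a. Qed.

Definition chart_mul (z : E * E) : E := phi (psi z.1 * psi z.2)%g.
Local Notation m := chart_mul.

Lemma chart_mul_twice : twice_differentiable m (a, a).
Proof.
apply: mul_twice_differentiable; try exact: chart1_atlas; try exact: cod_a.
by rewrite psi_a mulg1; exact: chart1_dom.
Qed.

Lemma chart_mul1r x : cod x -> m (x, a) = x.
Proof. by move=> cx; rewrite /m /= psi_a mulg1 chart_bwdK. Qed.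

Lemma chart_mul1l x : cod x -> m (a, x) = x.
Proof. by move=> cx; rewrite /m /= psi_a mul1g chart_bwdK. Qed.

Lemma near_mul_dom : \forall z \near (a, a), dom (psi z.1 * psi z.2)%g.
Proof.
have d1 : dom (psi a * psi a)%g by rewrite psi_a mulg1; exact: chart1_dom.
have := mul_cvg _ (bwd_fst_cvg a cod_a) (bwd_snd_cvg a cod_a).
by move=> /(_ _ _ (near_dom d1)); apply.
Qed.

End LieGroup.

Section Partial.
Variables (R : realType) (U V W : normedModType R).
Implicit Types (x : U) (y : V).

Lemma near_fst x y (P : set (U * V)) :
  (\forall z \near (x, y), P z) -> \forall t \near x, P (t, y).
Proof. by move=> Pz; exact: (cvg_pair (@cvg_id _ (nbhs x)) (cvg_cst y)) Pz. Qed.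

Lemma near_snd x y (P : set (U * V)) :
  (\forall z \near (x, y), P z) -> \forall t \near y, P (x, t).
Proof. by move=> Pz; exact: (cvg_pair (cvg_cst x) (@cvg_id _ (nbhs y))) Pz. Qed.

Lemma pair_cst_derive x y v : differentiable (fun t => (t, y)) x /\
  'D_v (fun t => (t, y)) x = (v, 0).
Proof.
have dx := @ex_diff _ _ _ _ _ _ _ (is_diff_id x).
have dy := differentiable_cst y x.
split; first exact: differentiable_pair.
by rewrite (derive_pair v dx dy) derive_id derive_cst.
Qed.

Lemma cst_pair_derive x y v : differentiable (fun t => (x, t)) y /\
  'D_v (fun t => (x, t)) y = (0, v).
Proof.
have dy := @ex_diff _ _ _ _ _ _ _ (is_diff_id y).
have dx := differentiable_cst x y.
split; first exact: differentiable_pair.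
by rewrite (derive_pair v dx dy) derive_id derive_cst.
Qed.

Lemma derive_fst (f : U * V -> W) x y v : differentiable f (x, y) ->
  differentiable (fun t => f (t, y)) x /\
  'D_v (fun t => f (t, y)) x = 'D_(v, 0) f (x, y).
Proof.
move=> df; have [d D] := pair_cst_derive x y v.
split; first exact: (differentiable_comp d df).
by rewrite -D -(derive_comp v d df).
Qed.

Lemma derive_snd (f : U * V -> W) x y v : differentiable f (x, y) ->
  differentiable (fun t => f (x, t)) y /\
  'D_v (fun t => f (x, t)) y = 'D_(0, v) f (x, y).
Proof.
move=> df; have [d D] := cst_pair_derive x y v.
split; first exact: (differentiable_comp d df).
by rewrite -D -(derive_comp v d df).
Qed.

End Partial.

(** * The bracket as a second derivative of the group law *)

Section LieBracket.
Variables (R : realType) (n : nat) (G : groupTopologicalType).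
Variable L : lie_group R n G.
Local Notation E := 'rV[R]_n.
Local Notation phi := (chart_fwd (chart1 L)).
Local Notation psi := (chart_bwd (chart1 L)).
Local Notation dom := (chart_dom (chart1 L)).
Local Notation cod := (chart_cod (chart1 L)).
Local Notation a := (phi 1%g).
Local Notation m := (chart_mul L).
Implicit Types u v w x y : E.

(** The bilinear term of the group law: as [m] is the identity on both axes, it equals a + x + y +
    [chart_hess x y] up to higher order at [(a + x, a + y)]. *)
Definition chart_hess u v : E := 'D_(u, 0) ('D_(0, v) m) (a, a).

Lemma left_fieldE v x : left_field L v x = 'd (fun y => m (x, y)) a v.
Proof. by []. Qed.

Lemma left_field_linear c u v x :
  left_field L (c *: u + v) x = c *: left_field L u x + left_field L v x.
Proof. by rewrite !left_fieldE linearP. Qed.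

Lemma left_field_near v :
  {near a, left_field L v =1 (fun x => 'D_(0, v) m (x, a))}.
Proof.
have := near_fst (chart_mul_twice L).1; apply: filterS => x dx.
have [d D] := derive_snd v dx.
by rewrite left_fieldE -D (deriveE _ d).
Qed.

Lemma left_field_derive v : differentiable (left_field L v) a /\
  forall u, 'D_u (left_field L v) a = chart_hess u v.
Proof.
have [_ m2] := chart_mul_twice L.
have nE : {near a, (fun x => 'D_(0, v) m (x, a)) =1 left_field L v}.
  by have := left_field_near v; apply: filterS => x ->.
split; first exact: near_eq_differentiable nE (derive_fst v (m2 (0, v))).1.
by move=> u; rewrite -(near_eq_derive _ nE) (derive_fst u (m2 (0, v))).2.
Qed.

Lemma left_field_a v : left_field L v a = v.
Proof.
rewrite (nbhs_singleton (left_field_near v)).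
have dm := nbhs_singleton (chart_mul_twice L).1.
rewrite -(derive_snd v dm).2.
have -> : 'D_v (fun t => m (a, t)) a = 'D_v id a.
  apply: near_eq_derive; have := near_cod (cod_a L); apply: filterS => x cx.
  exact: chart_mul1l.
by rewrite derive_id.
Qed.

Lemma lie_bracketE u v : lie_bracket L u v = chart_hess u v - chart_hess v u.
Proof.
have [du Du] := left_field_derive u; have [dv Dv] := left_field_derive v.
by rewrite -Du -Dv (deriveE v du) (deriveE u dv).
Qed.

Lemma chart_hess_linearl c u v w :
  chart_hess (c *: u + v) w = c *: chart_hess u w + chart_hess v w.
Proof.
by have [d D] := left_field_derive w; rewrite -!D (derive_linearP _ _ _ d).
Qed.

Lemma chart_hess_linearr c u v w :
  chart_hess w (c *: u + v) = c *: chart_hess w u + chart_hess w v.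
Proof.
have [du Du] := left_field_derive u; have [dv Dv] := left_field_derive v.
have [_ <-] := left_field_derive (c *: u + v); rewrite -Du -Dv.
have -> : left_field L (c *: u + v) = c *: left_field L u + left_field L v.
  by apply/funext => x; exact: left_field_linear.
have du' := diff_derivable (v := w) du; have dv' := diff_derivable (v := w) dv.
by rewrite (deriveD (derivableZ (k := c) du') dv') deriveZ.
Qed.

Lemma lie_bracket_linearl c u v w :
  lie_bracket L (c *: u + v) w = c *: lie_bracket L u w + lie_bracket L v w.
Proof.
by rewrite !lie_bracketE chart_hess_linearl chart_hess_linearr opprD addrACA scalerBr.
Qed.

Lemma lie_bracket_linearr c u v w :
  lie_bracket L w (c *: u + v) = c *: lie_bracket L w u + lie_bracket L w v.
Proof.
by rewrite !lie_bracketE chart_hess_linearl chart_hess_linearr opprD addrACA scalerBr.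
Qed.

Lemma lie_bracket_xx u : lie_bracket L u u = 0.
Proof. exact: subrr. Qed.

Section Homomorphism.
Variable F : G -> G.
Hypothesis F_morph : {morph F : x y / (x * y)%g}.
Hypothesis F_dom : \forall x \near a, dom (F (psi x)).
Variable f : E -> E.
Hypothesis fE : forall x, f x = phi (F (psi x)).
Hypothesis f_twice : twice_differentiable f a.

Lemma morph_a : f a = a.
Proof.
rewrite fE psi_a; have : F 1%g = (F 1 * F 1)%g by rewrite -F_morph mulg1.
by move/(congr1 (fun g => (F 1)^-1 * g)%g); rewrite mulVg mulgA mulVg mul1g => <-.
Qed.

Lemma chart_morph : \forall z \near (a, a), f (m z) = m (f z.1, f z.2).
Proof.
have n1 : \forall z \near (a, a), dom (F (psi z.1)) by exact: cvg_fst F_dom.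
have n2 : \forall z \near (a, a), dom (F (psi z.2)) by exact: cvg_snd F_dom.
near=> z; rewrite !fE /chart_mul /= chart_fwdK; last by near: z; exact: near_mul_dom.
by rewrite F_morph !chart_fwdK //; near: z.
Unshelve. all: by end_near. Qed.

(** Differentiates f(xy) = f(x)f(y) in [y] at the identity: [f] carries the left-invariant field of
    [v] to that of ['D_v f a]. *)
Lemma left_field_related v :
  \forall x \near a, 'D_(left_field L v x) f x = left_field L ('D_v f a) (f x).
Proof.
have [fd _] := f_twice; have df := nbhs_singleton fd.
have fc := differentiable_continuous df.
have nm := (chart_mul_twice L).1.
have c1 := near_fst (near_near chart_morph).
have c2 := near_fst nm.
have c5 : \forall x \near a, left_field L v x = 'D_(0, v) m (x, a).
  exact: left_field_near.
have c3 : \forall x \near a, differentiable m (f x, a).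
  by apply: (near_comp (P := fun y => differentiable m (y, a)) fc); rewrite morph_a.
have c4 : \forall x \near a,
    left_field L ('D_v f a) (f x) = 'D_(0, 'D_v f a) m (f x, a).
  apply: (near_comp (P := fun y => left_field L ('D_v f a) y =
    'D_(0, 'D_v f a) m (y, a)) fc).
  by rewrite morph_a; exact: left_field_near.
near=> x.
have dx : differentiable f x by near: x.
have dm : differentiable m (x, a) by near: x.
have cx : cod x by near: x; exact: near_cod (cod_a L).
have dmf : differentiable m (f x, f a).
  by rewrite morph_a; near: x.
have E1 : \forall y \near a, f (m (x, y)) = m (f x, f y).
  by apply: (@near_snd _ _ _ x a (fun z => f (m z) = m (f z.1, f z.2))); near: x.
have [d1 D1] := derive_snd v dm.
have [d2 D2] := derive_snd ('D_v f a) dmf.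
have -> : left_field L ('D_v f a) (f x) = 'D_(0, 'D_v f a) m (f x, f a).
  by rewrite morph_a; near: x.
rewrite -D2 -(derive_comp v df d2) -(near_eq_derive _ E1).
have dfx : differentiable f (m (x, a)) by rewrite chart_mul1r.
have E3 : left_field L v x = 'D_(0, v) m (x, a).
  near: x; exact: c5.
have := derive_comp v d1 dfx; rewrite D1 -E3 (chart_mul1r cx) => <-.
by [].
Unshelve. all: by end_near. Qed.

Lemma morph_lie_bracket u v :
  'D_(lie_bracket L u v) f a = lie_bracket L ('D_u f a) ('D_v f a).
Proof.
have df := nbhs_singleton f_twice.1.
(* [left_field_related] differentiated once more, along [u']. Exchanging the two vectors and
   subtracting cancels the second derivatives of [f] and leaves the brackets. *)
have H u' v' : 'D_u' ('D_v' f) a + 'D_(chart_hess u' v') f a =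
    chart_hess ('D_u' f a) ('D_v' f a).
  have [dv Dv] := left_field_derive v'.
  have [_ D] := @derive_along _ _ _ _ f id (left_field L v') a (@framed_rV _ _)
    f_twice (@ex_diff _ _ _ _ _ _ _ (is_diff_id a)) dv.
  have := D u'; rewrite left_field_a derive_id Dv => <-.
  rewrite (near_eq_derive _ (left_field_related v')).
  move: (left_field L ('D_v' f a)) (left_field_derive ('D_v' f a)) => lf [dw Dw].
  rewrite -Dw; have dw' : differentiable lf (f a) by rewrite morph_a.
  by have E1 := derive_comp u' df dw'; rewrite morph_a in E1; exact: E1.
apply: etrans (esym (lie_bracketE ('D_u f a) ('D_v f a))).
apply: etrans (congr2 (fun x y => x - y) (H u v) (H v u)).
rewrite lie_bracketE; have := schwarz_rV v u f_twice.
move: (chart_hess u v) (chart_hess v u) => w1 w2.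
move: ('D_u ('D_v f) a) ('D_v ('D_u f) a) => A B ->.
rewrite opprD addrACA subrr add0r.
have -> : w1 - w2 = -1 *: w2 + w1 by rewrite scaleN1r addrC.
by rewrite (derive_linearP _ _ _ df) scaleN1r addrC.
Qed.

End Homomorphism.
End LieBracket.

Section RowMaps.
Variables (R : realType) (n : nat).
Local Notation E := 'rV[R]_n.

Lemma derive_row_linear (W : normedModType R) (f : E -> W) x v :
  (forall c u v, f (c *: u + v) = c *: f u + f v) ->
  differentiable f x /\ 'D_v f x = f v.
Proof.
move=> lf.
have f0 : f 0 = 0 by have := lf (-1) 0 0; rewrite scaler0 addr0 scaleN1r addNr.
have fs y : f y = \sum_j y 0 j *: f (delta_mx 0 j).
  rewrite {1}[y]row_sum_delta; apply: (big_ind2 (fun s t => f s = t)) => //.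
    by move=> y1 y2 z1 z2 <- <-; have := lf 1 y1 z1; rewrite !scale1r.
  by move=> j _; have := lf (y 0 j) (delta_mx 0 j : E) 0; rewrite f0 !addr0.
have dj j : differentiable (fun y : E => y 0 j *: f (delta_mx 0 j)) x /\
    'D_v (fun y : E => y 0 j *: f (delta_mx 0 j)) x = v 0 j *: f (delta_mx 0 j).
  have [d D] := derive_coord v 0 j (@ex_diff _ _ _ _ _ _ _ (is_diff_id x)).
  have [ds Ds] := differentiable_scale d (differentiable_cst (f (delta_mx 0 j)) x).
  split; first exact: ds.
  by apply: etrans (Ds v) _; rewrite derive_cst scaler0 add0r D derive_id.
have fE : f = \sum_j (fun y : E => y 0 j *: f (delta_mx 0 j)).
  by apply/funext => y; rewrite fct_sumE.
rewrite {1 2}fE; split; first by apply: differentiable_sum => j; exact: (dj j).1.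
rewrite derive_sum => [|j]; last exact: diff_derivable (dj j).1.
by rewrite (fs v); apply: eq_bigr => j _; exact: (dj j).2.
Qed.

Lemma derive_row_bilinear (V : normedModType R) (b : E -> E -> E) (A B : V -> E) x v :
  (forall c u v w, b (c *: u + v) w = c *: b u w + b v w) ->
  (forall c u v w, b w (c *: u + v) = c *: b w u + b w v) ->
  differentiable A x -> differentiable B x ->
  'D_v (fun y => b (A y) (B y)) x = b ('D_v A x) (B x) + b (A x) ('D_v B x).
Proof.
move=> bl br dA dB.
have bs y z : b y z = \sum_j y 0 j *: b (delta_mx 0 j) z.
  have b0 : b 0 z = 0 by have := bl (-1) 0 0 z; rewrite scaler0 addr0 scaleN1r addNr.
  rewrite {1}[y]row_sum_delta.
  apply: (big_ind2 (fun s t => b s z = t)) => //.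
    by move=> y1 y2 z1 z2 <- <-; have := bl 1 y1 z1 z; rewrite !scale1r.
  by move=> j _; have := bl (y 0 j) (delta_mx 0 j : E) 0 z; rewrite b0 !addr0.
pose F j y := A y 0 j *: b (delta_mx 0 j) (B y).
have dF j : differentiable (F j) x /\
    'D_v (F j) x = A x 0 j *: b (delta_mx 0 j) ('D_v B x) +
                   ('D_v A x) 0 j *: b (delta_mx 0 j) (B x).
  have [d D] := derive_coord v 0 j dA.
  have lb c u w : b (delta_mx 0 j) (c *: u + w) =
    c *: b (delta_mx 0 j) u + b (delta_mx 0 j) w by exact: br.
  have [db Db] := derive_row_linear (B x) ('D_v B x) lb.
  have dbB := differentiable_comp dB db.
  have [ds Ds] := differentiable_scale d dbB.
  split; first exact: ds.
  apply: etrans (Ds v) _; rewrite D; congr (_ + _).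
  by congr (_ *: _); apply: etrans (derive_comp v dB db) _; exact: Db.
have -> : (fun y => b (A y) (B y)) = \sum_j F j.
  by apply/funext => y; rewrite fct_sumE bs.
rewrite derive_sum => [|j]; last exact: diff_derivable (dF j).1.
rewrite (bs ('D_v A x)) (bs (A x)) addrC -big_split /=.
by apply: eq_bigr => j _; exact: (dF j).2.
Qed.

End RowMaps.

(** * The adjoint representation and its derivative *)

Section Adjoint.
Variables (R : realType) (n : nat) (G : groupTopologicalType).
Variable L : lie_group R n G.
Local Notation E := 'rV[R]_n.
Local Notation phi := (chart_fwd (chart1 L)).
Local Notation psi := (chart_bwd (chart1 L)).
Local Notation dom := (chart_dom (chart1 L)).
Local Notation cod := (chart_cod (chart1 L)).
Local Notation a := (phi 1%g).
Local Notation m := (chart_mul L).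
Implicit Types u v w x y : E.

Definition chart_conj (g : G) x : E := phi (g * psi x * g^-1)%g.

Lemma conj_cvg (g : G) : (fun x => g * psi x * g^-1)%g @ a --> (1 : G)%g.
Proof.
have cg : (fun=> g) @ a --> g by apply: cvg_cst; exact: nbhs_filter.
have cg' : (fun=> g^-1%g) @ a --> (g^-1)%g.
  by apply: cvg_cst; exact: nbhs_filter.
have := mul_cvg L (nbhs_filter a) (mul_cvg L (nbhs_filter a) cg (psi_cvg1 L)) cg'.
by rewrite mulg1 mulgV.
Qed.

Lemma near_conj_dom (g : G) : \forall x \near a, dom (g * psi x * g^-1)%g.
Proof. exact: conj_cvg (near_dom (chart1_dom L)). Qed.

Lemma chart_conj_a g : chart_conj g a = a.
Proof. by rewrite /chart_conj psi_a mulg1 mulgV. Qed.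

(** Since [g] may lie far from the identity, conjugation is factored through charts at [g] and at
    its inverse: left translation into the chart [c], then right translation back to the chart at
    1. *)
Lemma chart_conj_twice g : twice_differentiable (chart_conj g) a.
Proof.
have [c Ac cg] := atlas_cover L g; have [c' Ac' cg'] := atlas_cover L (g^-1)%g.
pose b := chart_fwd c g; pose b' := chart_fwd c' (g^-1)%g.
have cb : chart_cod c b by exact: chart_fwd_cod.
have cb' : chart_cod c' b' by exact: chart_fwd_cod.
have Eb : chart_bwd c b = g by exact: chart_fwdK.
have Eb' : chart_bwd c' b' = (g^-1)%g by exact: chart_fwdK.
have A1 := chart1_atlas L.
pose M1 (z : E * E) := chart_fwd c (chart_bwd c z.1 * psi z.2)%g.
pose M2 (z : E * E) := phi (chart_bwd c z.1 * chart_bwd c' z.2)%g.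
have t1 : twice_differentiable M1 (b, a).
  apply: (mul_twice_differentiable Ac A1 Ac cb (cod_a L)).
  by rewrite Eb psi_a mulg1.
have M1a : M1 (b, a) = b by rewrite /M1 /= psi_a mulg1 Eb.
have t2 : twice_differentiable M2 (b, b').
  apply: (mul_twice_differentiable Ac Ac' A1 cb cb').
  by rewrite Eb Eb' mulgV; exact: chart1_dom.
have f2 := framed_prod (@framed_rV R n) (@framed_rV R n).
have t1' : twice_differentiable (M1 \o (fun x => (b, x))) a.
  apply: twice_differentiable_comp f2 _ _; last exact: t1.
  apply: twice_differentiable_pair; first exact: twice_differentiable_cst.
  exact: twice_differentiable_id.
have t2' : twice_differentiable (M2 \o (fun x => (x, b'))) (M1 (b, a)).
  rewrite M1a; apply: twice_differentiable_comp f2 _ _; last exact: t2.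
  apply: twice_differentiable_pair; last exact: twice_differentiable_cst.
  exact: twice_differentiable_id.
have t := twice_differentiable_comp (@framed_rV R n) t1' t2'.
apply: near_eq_twice_differentiable t.
have n1 : \forall x \near a, chart_dom c (g * psi x)%g.
  have cg1 : chart_dom c (g * 1)%g by rewrite mulg1.
  have cg0 : (fun=> g) @ a --> g by apply: cvg_cst; exact: nbhs_filter.
  exact: (mul_cvg L (nbhs_filter a) cg0 (psi_cvg1 L)) _ (near_dom cg1).
near=> x; rewrite /= /M2 /M1 /= Eb Eb' /chart_conj chart_fwdK //.
by near: x.
Unshelve. all: by end_near. Qed.

Lemma chart_conj_diff g : differentiable (chart_conj g) a.
Proof. exact: nbhs_singleton (chart_conj_twice g).1. Qed.

Lemma AdE g v : Ad L g v = 'D_v (chart_conj g) a.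
Proof. by rewrite (deriveE _ (chart_conj_diff g)). Qed.

Lemma Ad_linear g c u v : Ad L g (c *: u + v) = c *: Ad L g u + Ad L g v.
Proof. exact: linearP. Qed.

Lemma Ad_lie_bracket g u v :
  Ad L g (lie_bracket L u v) = lie_bracket L (Ad L g u) (Ad L g v).
Proof.
have Fm : {morph (fun h : G => g * h * g^-1)%g : x y / (x * y)%g}.
  by move=> x y; rewrite !mulgA -[(_ * g^-1 * g)%g]mulgA mulVg mulg1.
have := morph_lie_bracket Fm (near_conj_dom g) (f := chart_conj g)
  (fun=> erefl) (chart_conj_twice g) u v.
by rewrite -!AdE.
Qed.

Lemma Ad1 v : Ad L 1%g v = v.
Proof.
rewrite AdE -[RHS](derive_id a); apply: near_eq_derive.
have := near_cod (cod_a L); apply: filterS => x cx.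
by rewrite /chart_conj mul1g invg1 mulg1 chart_bwdK.
Qed.

Lemma AdM g h v : Ad L (g * h)%g v = Ad L g (Ad L h v).
Proof.
rewrite !AdE.
have dg := chart_conj_diff g; have dh := chart_conj_diff h.
have dg' : differentiable (chart_conj g) (chart_conj h a) by rewrite chart_conj_a.
have E1 := derive_comp v dh dg'; rewrite chart_conj_a in E1.
apply: etrans E1; apply: near_eq_derive.
have := near_conj_dom h; apply: filterS => x dx.
by rewrite /= /chart_conj chart_fwdK // invgM !mulgA.
Qed.

Definition chart_inv x : E := phi (psi x)^-1%g.

Lemma inv_cvg1 : (fun x => (psi x)^-1)%g @ a --> (1 : G)%g.
Proof. by have := inv_cvg L (nbhs_filter a) (psi_cvg1 L); rewrite invg1. Qed.

Lemma near_inv_dom : \forall x \near a, dom (psi x)^-1%g.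
Proof. exact: inv_cvg1 (near_dom (chart1_dom L)). Qed.

Lemma chart_inv_twice : twice_differentiable chart_inv a.
Proof.
apply: (smooth_map_twice_differentiable (lie_inv_smooth L) (chart1_atlas L)
  (chart1_atlas L) (cod_a L)).
by rewrite psi_a invg1; exact: chart1_dom.
Qed.

(** Conjugation as a function of both variables, built from [m] and [chart_inv] so that it is
    visibly a composite; it is compared with [chart_conj] only near [(a, a)]. *)
Definition chart_conj2 (z : E * E) : E := m (m z, chart_inv z.1).

Lemma chart_conj2_twice : twice_differentiable chart_conj2 (a, a).
Proof.
have f1 := @framed_rV R n; have f2 := framed_prod f1 f1.
have ia : chart_inv a = a by rewrite /chart_inv psi_a invg1.
have t1 : twice_differentiable (chart_inv \o fst) ((a, a) : E * E).
  apply: (twice_differentiable_comp f1); first exact: twice_differentiable_fst.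
  exact: chart_inv_twice.
have t2 := twice_differentiable_pair (chart_mul_twice L) t1.
apply: (twice_differentiable_comp f2 t2).
by rewrite /= ia chart_mul1r; [exact: chart_mul_twice|exact: cod_a].
Qed.

Lemma chart_conj2E : \forall z \near (a, a), chart_conj (psi z.1) z.2 = chart_conj2 z.
Proof.
have n1 : \forall z \near ((a, a) : E * E), dom (psi z.1)^-1%g.
  exact: cvg_fst near_inv_dom.
have n2 := near_mul_dom L.
near=> z; rewrite /chart_conj2 /chart_mul /= /chart_inv !chart_fwdK //; near: z.
  exact: n1.
exact: n2.
Unshelve. all: by end_near. Qed.

Lemma chart_conj2_mul : \forall z \near (a, a), m (chart_conj (psi z.1) z.2, z.1) = m z.
Proof.
have : \forall z \near (a, a), dom (psi z.1 * psi z.2 * (psi z.1)^-1)%g.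
  have c1 := mul_cvg L _ (bwd_fst_cvg a (cod_a L)) (bwd_snd_cvg a (cod_a L)).
  have c2 := inv_cvg L _ (bwd_fst_cvg a (cod_a L)).
  have c3 := mul_cvg L _ (c1 _) (c2 _).
  have d1 : dom (psi a * psi a * (psi a)^-1)%g.
    by rewrite psi_a mulg1 invg1 mulg1; exact: chart1_dom.
  exact: c3 _ (near_dom d1).
apply: filterS => z dz.
rewrite /chart_mul /= /chart_conj chart_fwdK // -[(_ * (psi z.1)^-1 * _)%g]mulgA.
by rewrite mulVg mulg1.
Qed.

Lemma Ad_near Y : \forall x \near a, Ad L (psi x) Y = 'D_(0, Y) chart_conj2 (x, a).
Proof.
have c1 := near_fst (near_near chart_conj2E).
have c2 := near_fst chart_conj2_twice.1.
near=> x; have d2 : differentiable chart_conj2 (x, a) by near: x; exact: c2.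
have E1 : \forall z \near (x, a), chart_conj (psi z.1) z.2 = chart_conj2 z.
  by near: x; exact: c1.
rewrite AdE -(derive_snd Y d2).2; apply: near_eq_derive.
exact: (near_snd E1).
Unshelve. all: by end_near. Qed.

Lemma Ad_chart1 Y : Ad L (psi a) Y = Y.
Proof. by rewrite psi_a Ad1. Qed.

Lemma Ad_differentiable Y : differentiable (fun x => Ad L (psi x) Y) a.
Proof.
have [_ m2] := chart_conj2_twice.
have nE : {near a, (fun x => 'D_(0, Y) chart_conj2 (x, a)) =1 (fun x => Ad L (psi x) Y)}.
  by have := Ad_near Y; apply: filterS => x ->.
exact: near_eq_differentiable nE (derive_fst 0 (m2 (0, Y))).1.
Qed.

(* Differentiates (x y x^-1) x = x y, first in y and then in x. *)
Lemma Ad_left_field Y :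
  \forall x \near a, 'D_(Ad L (psi x) Y, 0) m (a, x) = left_field L Y x.
Proof.
have c1 := near_fst (near_near chart_conj2_mul).
have c2 := near_fst (chart_mul_twice L).1.
have c3 := near_snd (chart_mul_twice L).1.
have c4 : \forall x \near a, left_field L Y x = 'D_(0, Y) m (x, a).
  exact: left_field_near.
near=> x; have d2 : differentiable m (x, a) by near: x; exact: c2.
have d3 : differentiable m (chart_conj (psi x) a, x).
  by rewrite chart_conj_a; near: x; exact: c3.
have -> : left_field L Y x = 'D_(0, Y) m (x, a) by near: x; exact: c4.
rewrite -(derive_snd Y d2).2.
have E1 : \forall y \near a, m (chart_conj (psi x) y, x) = m (x, y).
  have : \forall z \near (x, a), m (chart_conj (psi z.1) z.2, z.1) = m z.
    by near: x; exact: c1.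
  exact: near_snd.
rewrite -(near_eq_derive Y E1) AdE.
have [d4 D4] := derive_fst ('D_Y (chart_conj (psi x)) a) d3.
have E2 := derive_comp Y (chart_conj_diff (psi x)) d4.
rewrite D4 chart_conj_a in E2.
exact: esym E2.
Unshelve. all: by end_near. Qed.

Lemma chart_mul_derive_fst w : 'D_(w, 0) m (a, a) = w.
Proof.
have dm := nbhs_singleton (chart_mul_twice L).1.
have [_ <-] := derive_fst w dm; rewrite -[RHS](derive_id a).
apply: near_eq_derive; have := near_cod (cod_a L); apply: filterS => x cx.
exact: chart_mul1r.
Qed.

(** [Ad_left_field] differentiated at [a] along [u]: the right side gives [chart_hess u Y], the left
    side the derivative sought plus, by symmetry of the second derivative of [m],
    [chart_hess Y u]. *)
Lemma derive_Ad u Y : 'D_u (fun x => Ad L (psi x) Y) a = lie_bracket L u Y.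
Proof.
have f1 := @framed_rV R n; have f2 := framed_prod f1 f1.
have [d1 D1] := cst_pair_derive a a u.
have dA := Ad_differentiable Y.
have dw := differentiable_pair dA (differentiable_cst (0 : E) a).
have [_ D] := derive_along f2 (chart_mul_twice L) d1 dw.
have := D u; rewrite (near_eq_derive _ (Ad_left_field Y)) D1.
rewrite (derive_pair u dA (differentiable_cst (0 : E) a)) derive_cst Ad_chart1.
rewrite (schwarz_rV (Y, 0) (0, u) (chart_mul_twice L)) => H.
have {}H := etrans (esym ((left_field_derive L Y).2 u)) H.
rewrite lie_bracketE H -/(chart_hess L Y u) addrAC subrr add0r.
exact: esym (chart_mul_derive_fst _).
Qed.

(** The infinitesimal form of [Ad_lie_bracket], whose two sides are differentiated at the
    identity. *)
Lemma lie_bracket_jacobi u v w : lie_bracket L u (lie_bracket L v w) =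
  lie_bracket L (lie_bracket L u v) w + lie_bracket L v (lie_bracket L u w).
Proof.
rewrite -derive_Ad.
have -> : (fun x => Ad L (psi x) (lie_bracket L v w)) =
    (fun x => lie_bracket L (Ad L (psi x) v) (Ad L (psi x) w)).
  by apply/funext => x; exact: Ad_lie_bracket.
rewrite (derive_row_bilinear u (lie_bracket_linearl L)
  (lie_bracket_linearr L) (Ad_differentiable v) (Ad_differentiable w)).
by rewrite !derive_Ad !Ad_chart1.
Qed.

End Adjoint.

(** * Inverse functions and curves of fixed points *)

Section ClassC.
Variables (R : realType) (V : normedModType R) (U : set V).
Hypothesis U_open : open U.
Implicit Types (W : normedModType R) (k : nat).

Lemma near_in_open x : U x -> \forall y \near x, U y.
Proof. by move=> Ux; apply: open_nbhs_nbhs. Qed.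

Lemma class_C_congr W k (f g : V -> W) :
  (forall x, U x -> f x = g x) -> class_C k U f -> class_C k U g.
Proof.
elim: k f g => [|k IHk] f g fg.
  move=> cf x; rewrite inE => Ux; have fgx : {near x, f =1 g}.
    by apply: filterS (near_in_open Ux) => y; exact: fg.
  rewrite /continuous_at -(fg x Ux); apply: cvg_trans (cf x _); last by rewrite inE.
  exact: near_eq_cvg.
move=> [df Cf]; split=> [x Ux|v].
  apply: near_eq_differentiable (df x Ux).
  by apply: filterS (near_in_open Ux) => y; exact: fg.
apply: IHk (Cf v) => x Ux; apply: near_eq_derive.
by apply: filterS (near_in_open Ux) => y; exact: fg.
Qed.

Lemma class_C_le W k (f : V -> W) : class_C k.+1 U f -> class_C k U f.
Proof.
elim: k f => [|k IHk] f [df Cf].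
  by move=> x; rewrite inE => /df; exact: differentiable_continuous.
by split=> // v; apply: IHk; exact: Cf.
Qed.

Lemma class_C_cst W k (w : W) : class_C k U (fun=> w).
Proof.
elim: k w => [|k IHk] w; first by move=> x _; exact: cvg_cst.
split=> [x _|v]; first exact: differentiable_cst.
apply: class_C_congr (IHk 0) => x _; by rewrite derive_cst.
Qed.

Lemma class_CD W k (f g : V -> W) :
  class_C k U f -> class_C k U g -> class_C k U (fun x => f x + g x).
Proof.
elim: k f g => [|k IHk] f g.
  by move=> cf cg x Ux; apply: cvgD; [exact: cf|exact: cg].
move=> [df Cf] [dg Cg]; split=> [x Ux|v].
  exact: (differentiableD (df x Ux) (dg x Ux)).
apply: class_C_congr (IHk _ _ (Cf v) (Cg v)) => x Ux.
exact/esym/(deriveD (diff_derivable (df x Ux)) (diff_derivable (dg x Ux))).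
Qed.

Lemma class_C_sum W k m (f : 'I_m -> V -> W) :
  (forall i, class_C k U (f i)) -> class_C k U (fun x => \sum_i f i x).
Proof.
elim: m f => [|m IHm] f Cf.
  by apply: class_C_congr (class_C_cst k 0) => x _; rewrite big_ord0.
have := class_CD (Cf ord0) (IHm (fun i => f (lift ord0 i)) (fun i => Cf _)).
by apply: class_C_congr => x _; rewrite big_ord_recl.
Qed.

Lemma class_CZ W k (c : V -> R) (f : V -> W) :
  class_C k U c -> class_C k U f -> class_C k U (fun x => c x *: f x).
Proof.
elim: k c f => [|k IHk] c f.
  by move=> cc cf x Ux; apply: cvgZ; [exact: cc|exact: cf].
move=> Cc Cf; have [dc Dc] := Cc; have [df Df] := Cf; split=> [x Ux|v].
  exact: (differentiable_scale (dc x Ux) (df x Ux)).1.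
have := class_CD (IHk _ _ (class_C_le Cc) (Df v)) (IHk _ _ (Dc v) (class_C_le Cf)).
apply: class_C_congr => x Ux.
by rewrite (differentiable_scale (dc x Ux) (df x Ux)).2.
Qed.

Lemma class_C_lin W (W' : normedModType R) k (f : V -> W) (l : W -> W') :
  (forall x v, differentiable l x /\ 'D_v l x = l v) ->
  class_C k U f -> class_C k U (fun x => l (f x)).
Proof.
move=> lE; elim: k f => [|k IHk] f.
  move=> cf x Ux; apply: (@continuous_comp _ _ _ f l); first exact: cf.
  exact: differentiable_continuous (lE _ 0).1.
move=> [df Df]; split=> [x Ux|v].
  exact: differentiable_comp (df x Ux) (lE _ 0).1.
apply: class_C_congr (IHk _ (Df v)) => x Ux; apply/esym.
by apply: etrans (derive_comp v (df x Ux) (lE _ 0).1) _; rewrite (lE _ _).2.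
Qed.

Lemma class_C_coord k m n (f : V -> 'M[R]_(m, n)) i j :
  class_C k U f -> class_C k U (fun x => f x i j).
Proof.
apply: (@class_C_lin _ _ k f (fun M : 'M[R]_(m, n) => M i j)) => x v.
have [d D] := derive_coord v i j (@ex_diff _ _ _ _ _ _ _ (is_diff_id x)).
by split=> //; rewrite D derive_id.
Qed.

Lemma class_CM k (c d : V -> R) :
  class_C k U c -> class_C k U d -> class_C k U (fun x => c x * d x).
Proof. exact: class_CZ. Qed.

Lemma class_CV k (c : V -> R) : (forall x, U x -> c x != 0) ->
  class_C k U c -> class_C k U (fun x => (c x)^-1).
Proof.
move=> c0; elim: k => [|k IHk].
  move=> cc x Ux; apply: cvgV; last exact: cc.
  by apply: c0; move: Ux; rewrite inE.
move=> Cc; have [dc Dc] := Cc; split=> [x Ux|v].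
  exact: (differentiableV (dc x Ux) (c0 x Ux)).
have C1 := IHk (class_C_le Cc).
have := class_CM (class_C_cst k (-1 : R)) (class_CM (class_CM C1 C1) (Dc v)).
apply: class_C_congr => x Ux.
rewrite (@deriveV _ _ c x v (c0 x Ux) (diff_derivable (dc x Ux))).
by rewrite mulN1r scaleNr -expr2 exprVn.
Qed.

Lemma class_C_prod k m (c : 'I_m -> V -> R) :
  (forall i, class_C k U (c i)) -> class_C k U (fun x => \prod_i c i x).
Proof.
elim: m c => [|m IHm] c Cc.
  by apply: class_C_congr (class_C_cst k (1 : R)) => x _; rewrite big_ord0.
have := class_CM (Cc ord0) (IHm (fun i => c (lift ord0 i)) (fun i => Cc _)).
by apply: class_C_congr => x _; rewrite big_ord_recl.
Qed.

Lemma class_C_det k m (J : V -> 'M[R]_m) :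
  (forall i j, class_C k U (fun x => J x i j)) -> class_C k U (fun x => \det (J x)).
Proof.
move=> CJ; rewrite /determinant.
have C s := class_CM (class_C_cst k ((-1) ^+ perm.odd_perm s : R))
  (class_C_prod (fun i => CJ i (s i))).
apply: class_C_congr (class_C_sum (fun i : 'I_#|{: {perm 'I_m}}| => C (enum_val i))).
by move=> x _; rewrite [RHS](reindex _ (onW_bij _ (enum_val_bij _))).
Qed.

Lemma class_C_invmx k m (J : V -> 'M[R]_m) :
  (forall x, U x -> J x \in unitmx) ->
  (forall i j, class_C k U (fun x => J x i j)) ->
  forall i j, class_C k U (fun x => invmx (J x) i j).
Proof.
move=> Ju CJ i j.
have Cdet : class_C k U (fun x => (\det (J x))^-1).
  apply: class_CV; last exact: class_C_det.
  by move=> x Ux; rewrite -unitfE -[_ \is a _]/(J x \in unitmx) Ju.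
have Cadj : class_C k U (fun x => \det (row' j (col' i (J x)))).
  apply: class_C_det => i' j'.
  by apply: class_C_congr (CJ (lift j i') (lift i j')) => x _; rewrite !mxE.
have := class_CM Cdet (class_CM (class_C_cst k ((-1) ^+ (j + i) : R)) Cadj).
by apply: class_C_congr => x Ux; rewrite /invmx Ju // !mxE.
Qed.

End ClassC.

(** * An inverse function theorem on a ball *)

Section LocalInverse.
Variables (R : realType) (n : nat).
Local Notation E := 'rV[R]_n.
Implicit Types (x y z u v w : E).

Lemma coord_le_norm w j : `|w 0 j| <= `|w|.
Proof.
rewrite [leRHS]/Num.Def.normr /= mx_normrE.
exact: (le_bigmax _ (fun i : 'I_1 * 'I_n => `|w i.1 i.2|) (0, j)).
Qed.

Lemma norm_le_coord w c : 0 <= c -> (forall j, `|w 0 j| <= c) -> `|w| <= c.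
Proof.
move=> c0 wc; rewrite [leLHS]/Num.Def.normr /= mx_normrE.
by apply: bigmax_le => //= -[i j] _ /=; rewrite ord1.
Qed.

(** The mean value theorem is applied to each coordinate along the segment; as the norm is the
    maximum of the coordinates, the constant does not deteriorate. *)
Lemma lipschitz_of_derive (h : E -> E) a rho q : 0 <= q ->
  (forall z, `|z - a| <= rho ->
    differentiable h z /\ forall u, `|'D_u h z| <= q * `|u|) ->
  forall x y, `|x - a| <= rho -> `|y - a| <= rho ->
    `|h x - h y| <= q * `|x - y|.
Proof.
move=> q0 dh x y xa ya; apply: norm_le_coord => [|j]; first exact: mulr_ge0.
pose g (t : R) := y + t *: (x - y).
have ga t : 0 <= t <= 1 -> `|g t - a| <= rho.
  move=> /andP[t0 t1].
  have -> : g t - a = t *: (x - a) + (1 - t) *: (y - a).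
    rewrite scalerBl scale1r addrCA -scalerBr opprB addrA subrK.
    by rewrite /g addrAC.
  rewrite (le_trans (ler_normD _ _)) // !normrZ ger0_norm // ger0_norm ?subr_ge0 //.
  have -> : rho = t * rho + (1 - t) * rho by ring.
  by rewrite lerD // ler_wpM2l // subr_ge0.
pose f (t : R) := h (g t) 0 j.
have df (t : R) : 0 <= t <= 1 -> differentiable (f : R -> R) t /\
    'D_1 f t = ('D_(x - y) h (g t)) 0 j.
  move=> /ga /dh[d _]; have [dl Dl] := line_derive y (x - y) t.
  have dhg := differentiable_comp dl d.
  have [dc Dc] := derive_coord (1 : R) 0 j dhg.
  split; first exact: dc.
  by apply: etrans Dc _; rewrite (derive_comp (1 : R) dl d) Dl.
have [||c cs Ef] := @MVT R f (fun t => ('D_(x - y) h (g t)) 0 j) 0 1 ltr01.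
- move=> t; rewrite in_itv /= => /andP[t0 t1].
  have [|d <-] := df t; first by rewrite !ltW.
  by apply: DeriveDef => //; exact: diff_derivable.
- apply: continuous_in_subspaceT => t; rewrite inE /= in_itv /= => t01.
  by have [/differentiable_continuous] := df t t01.
have -> : (h x - h y) 0 j = f 1 - f 0.
  by rewrite /f /g scale1r scale0r addr0 [y + _]addrC subrK !mxE.
rewrite Ef subr0 mulr1; apply: le_trans (coord_le_norm _ _) _.
apply: (dh _ _).2; apply: ga; move: cs; rewrite in_itv /= => /andP[c0 c1].
by rewrite !ltW.
Qed.

Lemma near_derive_close (Psi : E -> E) a e : 0 < e ->
  (\forall z \near a, differentiable Psi z) ->
  (forall v, {for a, continuous ('D_v Psi)}) -> (forall v, 'D_v Psi a = v) ->
  \forall z \near a, forall u, `|u - 'D_u Psi z| <= e * `|u|.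
Proof.
(* A sum of [n] terms of size [d] stays below [e]; [n.+1] avoids a division by zero when [n = 0]. *)
move=> e0 dP cP D1; pose d := e / n.+1%:R.
have d0 : 0 < d by rewrite divr_gt0 // ltr0n.
have nj j : \forall z \near a, `|delta_mx 0 j - 'D_(delta_mx 0 j) Psi z| <= d.
  have : 'D_(delta_mx 0 j : E) Psi @ a --> (delta_mx 0 j : E).
    by rewrite -[X in _ --> X]D1; exact: cP.
  by move=> /cvgrPdist_le; apply; exact: d0.
have {}nj := filter_forall (nbhs_filter a) nj.
near=> z => u; have dz : differentiable Psi z by near: z.
have uE : u - 'D_u Psi z =
    \sum_j u 0 j *: (delta_mx 0 j - 'D_(delta_mx 0 j) Psi z).
  rewrite {1 2}[u]row_sum_delta (deriveE _ dz) linear_sum -sumrB.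
  by apply: eq_bigr => j _; rewrite linearZ (deriveE _ dz) scalerBr.
rewrite uE; apply: le_trans (ler_norm_sum _ _ _) _.
have : \sum_j `|u 0 j *: (delta_mx 0 j - 'D_(delta_mx 0 j) Psi z)| <=
    \sum_(j < n) (`|u| * d).
  apply: ler_sum => j _; rewrite normrZ ler_pM // ?coord_le_norm //.
  by move: j; near: z.
move/le_trans; apply; rewrite sumr_const card_ord -mulr_natr.
rewrite -mulrA [e * _]mulrC ler_wpM2l // /d -mulrA ger_pMr // mulrC.
by rewrite ler_pdivrMr ?ltr0n // mul1r ler_nat.
Unshelve. all: by end_near. Qed.

HB.instance Definition _ := Complete.on E.

(** Near [a] the map [h = id - Psi] contracts by 1/2. This bounds |x - y| by twice |Psi x - Psi y|,
    and it turns [Psi x = w] into a fixed point problem for [h + w], which preserves the closed ball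
    of radius [rho] when |w| <= rho / 2. *)
Lemma local_inverse (Psi : E -> E) a (P : set E) :
  (\forall z \near a, differentiable Psi z) ->
  (forall v, {for a, continuous ('D_v Psi)}) -> (forall v, 'D_v Psi a = v) ->
  Psi a = 0 -> (\forall z \near a, P z) ->
  exists2 rho, 0 < rho &
  [/\ forall z, `|z - a| <= rho -> P z,
      forall x y, `|x - a| <= rho -> `|y - a| <= rho ->
        `|x - y| <= `|Psi x - Psi y| *+ 2 &
      forall w, `|w| <= rho / 2 -> exists2 x, `|x - a| <= rho & Psi x = w].
Proof.
move=> dP cP D1 Psia Pa.
have half0 : 0 < 2^-1 :> R by rewrite invr_gt0.
have nD := near_derive_close half0 dP cP D1.
have : \forall z \near a, [/\ P z, differentiable Psi z &
    forall u, `|u - 'D_u Psi z| <= 2^-1 * `|u|].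
  by near=> z; split; near: z.
move=> /nbhs_normP[rho0 /= rho00 H].
(* Halved so that the closed ball of radius [rho] lies in the open one of radius [rho0]. *)
pose rho := rho0 / 2; have rho_gt0 : 0 < rho by rewrite divr_gt0.
have {}H z : `|z - a| <= rho -> [/\ P z, differentiable Psi z &
    forall u, `|u - 'D_u Psi z| <= 2^-1 * `|u|].
  move=> za; apply: H; rewrite /ball_ /= distrC (le_lt_trans za) //.
  by rewrite /rho ltr_pdivrMr // ltr_pMr // ltr1n.
pose h := id - Psi.
have lip : forall x y, `|x - a| <= rho -> `|y - a| <= rho ->
    `|h x - h y| <= 2^-1 * `|x - y|.
  apply: lipschitz_of_derive; first exact: ltW.
  move=> z /H[_ dz Dz]; have di := @ex_diff _ _ _ _ _ _ _ (is_diff_id z).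
  split; first exact: (differentiableB di dz).
  move=> u; rewrite (deriveB (diff_derivable di) (diff_derivable dz)) derive_id.
  exact: Dz.
have hE x : h x = x - Psi x by [].
exists rho => //; split.
- by move=> z /H[].
- move=> x y xa ya; have := lip x y xa ya; rewrite !hE => le.
  have : `|x - y| <= 2^-1 * `|x - y| + `|Psi x - Psi y|.
    have {1}-> : x - y = (x - Psi x - (y - Psi y)) + (Psi x - Psi y).
      by move: (Psi x) (Psi y) => ? ?; apply/rowP => j; rewrite !mxE; ring.
    by rewrite (le_trans (ler_normD _ _)) // lerD2r.
  rewrite -lerBlDl -{1}[`|x - y|]mul1r -mulrBl.
  have -> : 1 - 2^-1 = 2^-1 :> R by rewrite {1}(splitr 1) mul1r addrK.
  by rewrite ler_pdivrMl // mulr_natl.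
move=> w wrho.
pose B : set E := closed_ball_ Num.Def.normr a rho.
have aB : B a by rewrite /B /closed_ball_ /= subrr normr0 ltW.
have BE z : B z -> `|z - a| <= rho by rewrite /B /closed_ball_ /= distrC.
have Tfun : set_fun B B (fun z => h z + w).
  move=> z /BE Bz; have := lip z a Bz (BE _ aB); rewrite [h a]hE Psia subr0.
  move=> le; rewrite /B /closed_ball_ /= distrC.
  rewrite addrAC (le_trans (ler_normD _ _)) //.
  rewrite (le_trans (lerD le wrho)) // /rho.
  by rewrite [X in _ <= X]splitr lerD // mulrC ler_wpM2r // invr_ge0.
pose T : {fun B >-> B} := HB.pack (fun z => h z + w) (isFun.Build _ _ B B _ Tfun).
have ctrT : is_contraction T.
  exists (2^-1)%:nng; split; first by rewrite /= invf_lt1 // ltr1n.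
  move=> [x y] /= [/BE Bx /BE By].
  by rewrite opprD addrACA subrr addr0; exact: lip.
have closedB : closed B by exact: closed_closed_ball_.
have [x Bx xT] := banach_fixed_point ctrT closedB (ex_intro _ a aB).
exists x; first exact: BE.
move/eqP: xT; rewrite /= hE -addrA -subr_eq0 opprD addrA subrr add0r oppr_eq0.
by rewrite addrC subr_eq0 eq_sym => /eqP.
Unshelve. all: by end_near. Qed.

End LocalInverse.

Section InverseCurve.
Variables (R : realType) (n : nat).
Local Notation E := 'rV[R]_n.
Implicit Types (u v w y z : E) (Psi : E -> E).

Definition derive_mx Psi y : 'M[R]_n :=
  \matrix_(i, j) ('D_(delta_mx 0 i : E) Psi y) 0 j.

Lemma mul_derive_mx Psi y u : differentiable Psi y ->
  u *m derive_mx Psi y = 'D_u Psi y.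
Proof.
move=> dP; rewrite mulmx_sum_row {2}[u]row_sum_delta (deriveE _ dP) linear_sum.
apply: eq_bigr => i _; rewrite linearZ /= -(deriveE _ dP); congr (_ *: _).
by apply/rowP => j; rewrite !mxE.
Qed.

Lemma norm_mulmx_le (M : 'M[R]_n) : exists2 C, 0 < C & forall u, `|u *m M| <= C * `|u|.
Proof.
exists (1 + \sum_i `|row i M|) => [|u].
  by rewrite ltr_pwDl ?ltr01 // sumr_ge0.
rewrite mulmx_sum_row (le_trans (ler_norm_sum _ _ _)) //.
rewrite mulrDl mul1r mulr_suml ler_wpDl // ler_sum // => i _.
by rewrite normrZ mulrC ler_wpM2l // coord_le_norm.
Qed.

Variables (U : set E) (Psi : E -> E) (x : R -> E) (v : E) (e K : R).
Hypothesis U_open : open U.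
Hypothesis Psi_smooth : smooth_on U Psi.
Hypothesis Psi_unit : forall y, U y -> derive_mx Psi y \in unitmx.
Hypothesis xU : forall t, `|t| < e -> U (x t).
Hypothesis Psi_x : forall t, `|t| < e -> Psi (x t) = t *: v.
Hypothesis K_gt0 : 0 < K.
Hypothesis x_lip : forall s t, `|s| < e -> `|t| < e ->
  `|x s - x t| <= K * `|s - t|.

Let J := derive_mx Psi.

(** So far [x] is only Lipschitz. With [k] its increment over [h], differentiability of [Psi] gives
    h v - k J = o(k), which is o(h) by the Lipschitz bound; the inverse of [J] then yields the
    derivative. *)
Lemma inverse_curve_derive (t : R) : `|t| < e ->
  derivable (x : R -> E) t 1 /\ 'D_1 x t = v *m invmx (J (x t)).
Proof.
move=> te; have dP : differentiable Psi (x t) by apply: (Psi_smooth 1).1; exact: xU.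
have Ju : J (x t) \in unitmx by apply/Psi_unit/xU.
set w := v *m _.
suff xw : h^-1 *: ((x \o shift t) (h *: (1 : R)) - x t) @[h --> 0^'] --> w.
  split; first by apply/cvg_ex; exists w.
  exact: (cvg_lim _ xw).
apply/cvgrPdist_le => e0 e00.
have [C C0 leC] := norm_mulmx_le (invmx (J (x t))).
(* [C] is lost in applying the inverse of [J], [K] in passing from |k| to |h|. *)
pose eta := e0 / (C * K); have eta0 : 0 < eta by rewrite divr_gt0 ?mulr_gt0.
have /nbhs_normP[rho /= rho0 Hrho] := differentiable_near_le eta0 dP.
have rK0 : 0 < rho / K by rewrite divr_gt0.
have et0 : 0 < e - `|t| by rewrite subr_gt0.
near=> h.
have h0 : h != 0 by near: h; exact: nbhs_dnbhs_neq.
have hr : `|h| < rho / K by near: h; exact: dnbhs0_lt.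
have het : `|h| < e - `|t| by near: h; exact: dnbhs0_lt.
have hte : `|h + t| < e.
  by rewrite (le_lt_trans (ler_normD _ _)) // -ltrBrDr.
have hE : h *: (1 : R^o) = h by rewrite /GRing.scale /= mulr1.
rewrite /= hE; have := x_lip hte te; rewrite addrK; set k := x (h + t) - x t => lek.
have krho : `|k| < rho by rewrite (le_lt_trans lek) // mulrC -ltr_pdivlMr.
have := Hrho k; rewrite /ball_ /= sub0r normrN => /(_ krho).
have -> : x t + k = x (h + t) by rewrite addrC subrK.
rewrite (Psi_x hte) (Psi_x te) -(mul_derive_mx _ dP) -/J => lek2.
have -> : w - h^-1 *: k =
    h^-1 *: (((h + t) *: v - t *: v - k *m J (x t)) *m invmx (J (x t))).
  rewrite -scalerBl addrK (mulmxBl (h *: v)) -scalemxAl mulmxK // -/w.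
  by rewrite (scalerBr _ (h *: w)) scalerA mulVf // scale1r.
rewrite normrZ normfV ler_pdivrMl ?normr_gt0 //.
rewrite (le_trans (leC _)) // (le_trans (ler_wpM2l (ltW C0) lek2)) //.
rewrite (le_trans (ler_wpM2l (ltW C0) (ler_wpM2l (ltW eta0) lek))) //.
rewrite le_eqVlt; apply/orP; left; apply/eqP.
by rewrite /eta; field; rewrite !gt_eqF.
Unshelve. all: by end_near. Qed.

(* The derivative of [F \o x] is again some smooth [F'] composed with [x], hence
   the quantification over [F] in the induction on [k]. *)
Lemma inverse_curve_comp (W : normedModType R) k (F : E -> W) : smooth_on U F ->
  class_C k (ball (0 : R^o) e) (fun t : R^o => F (x t)).
Proof.
have Bo : open (ball (0 : R^o) e) by exact: ball_open.
have Be (t : R^o) : ball (0 : R^o) e t -> `|t| < e.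
  by rewrite -ball_normE /ball_ /= sub0r normrN.
have dx (t : R^o) : ball (0 : R^o) e t -> differentiable (x : R^o -> E) t /\
    forall s, 'D_s (x : R^o -> E) t = s *: (v *m invmx (J (x t))).
  move=> /Be te; have [d D] := inverse_curve_derive te.
  have dd : differentiable (x : R^o -> E) t by apply/derivable1_diffP; exact: d.
  split=> // s; rewrite -D !(deriveE _ dd) -linearZ /=; congr ('d _ _ _).
  by rewrite /GRing.scale /= mulr1.
have CJ i j : smooth_on U (fun y => invmx (J y) i j).
  move=> m; apply: (class_C_invmx U_open) => // i' j'.
  have := class_C_coord U_open 0 j' ((Psi_smooth m.+1).2 (delta_mx 0 i' : E)).
  by apply: class_C_congr => // y _; rewrite mxE.
elim: k F => [|k IHk] F CF.
  move=> t; rewrite inE => Bt.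
  apply: (@continuous_comp _ _ _ (x : R^o -> E) F).
    exact: differentiable_continuous (dx t Bt).1.
  by apply: (CF 0); rewrite inE; apply/xU/Be.
split=> [t Bt|s].
  apply: (@differentiable_comp _ _ _ _ (x : R^o -> E) F _ (dx t Bt).1).
  exact: ((CF 1).1 _ (xU (Be _ Bt))).
pose Hs y := \sum_j (s *: (v *m invmx (J y))) 0 j *: 'D_(delta_mx 0 j : E) F y.
have CHs : smooth_on U Hs.
  move=> m; apply: (class_C_sum U_open) => j.
  apply: (class_CZ U_open); last exact: (CF m.+1).2.
  have := class_C_sum U_open (fun i => class_CM U_open
    (class_C_cst U_open m (s * v 0 i)) (CJ i j m)).
  apply: class_C_congr => // y _; rewrite !mxE mulr_sumr.
  by apply: eq_bigr => i _; rewrite mulrA.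
apply: (class_C_congr Bo _ (IHk _ CHs)) => t Bt.
have dF : differentiable F (x t) by exact: ((CF 1).1 _ (xU (Be _ Bt))).
have [d D] := dx t Bt.
apply/esym/(etrans (derive_comp s d dF)); rewrite D /Hs.
move: (s *: _) => u; rewrite (deriveE _ dF) {1}[u]row_sum_delta linear_sum.
by apply: eq_bigr => j _; rewrite linearZ (deriveE _ dF).
Qed.

Lemma inverse_curve_smooth : smooth_on (ball (0 : R^o) e) (fun t : R^o => x t).
Proof.
move=> k; apply: (@inverse_curve_comp E k id) => m.
elim: m => [|m _]; first by move=> y _; exact: cvg_id.
split=> [y _|u]; first exact: (@ex_diff _ _ _ _ _ _ _ (is_diff_id y)).
by apply: (class_C_congr U_open _ (class_C_cst U_open m u)) => y _; rewrite derive_id.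
Qed.

End InverseCurve.

(** * Curves of fixed points of a smooth local involution *)

Section FixedCurve.
Variables (R : realType) (n : nat).
Local Notation E := 'rV[R]_n.
Implicit Types (u v w x y z : E).

Lemma class_C_subset (V W : normedModType R) k (A B : set V) (f : V -> W) :
  A `<=` B -> class_C k B f -> class_C k A f.
Proof.
move=> AB; elim: k f => [|k IHk] f.
  by move=> cf x; rewrite inE => /AB Bx; apply: cf; rewrite inE.
by move=> [df Df]; split=> [x /AB/df|v]; [|exact: IHk (Df v)].
Qed.

Lemma derive_mx_unit (f : E -> E) y : differentiable f y ->
  (forall u, `|u - 'D_u f y| <= 2^-1 * `|u|) -> derive_mx f y \in unitmx.
Proof.
move=> df fy; rewrite -row_free_unit; apply: inj_row_free => u.
rewrite mul_derive_mx // => Du; have := fy u; rewrite Du subr0.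
rewrite -{1}[`|u|]mul1r -subr_ge0 -mulrBl => u2.
apply/eqP; rewrite -normr_le0; move: u2.
by rewrite nmulr_rge0 // subr_lt0 invf_lt1 ?ltr1n.
Qed.

Variables (f : E -> E) (V : set E) (a v : E).
Hypothesis f_smooth : smooth_on V f.
Hypothesis Va : \forall z \near a, V z.
Hypothesis fa : f a = a.
Hypothesis ffz : \forall z \near a, f (f z) = z.
Hypothesis fv : 'D_v f a = v.

Let S u := 'D_u f a.
Let Psi z := 2^-1 *: ((z - a) + S (f z - a)).

Let df_a : differentiable f a.
Proof. by apply: (f_smooth 1).1; exact: nbhs_singleton Va. Qed.

Let S_linear c u w : S (c *: u + w) = c *: S u + S w.
Proof. exact: derive_linearP. Qed.

Let SS u : S (S u) = u.
Proof.
have df' : differentiable f (f a) by rewrite fa.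
have := derive_comp u df_a df'; rewrite fa => Dff; apply: etrans (esym Dff) _.
by rewrite (near_eq_derive _ (_ : {near a, f \o f =1 id})) ?derive_id.
Qed.

Let SD u w : S (u + w) = S u + S w.
Proof. by have := S_linear 1 u w; rewrite !scale1r. Qed.

Let S0 : S 0 = 0.
Proof. by apply: (addrI (S 0)); rewrite -SD !addr0. Qed.

Let SZ c u : S (c *: u) = c *: S u.
Proof. by have := S_linear c u 0; rewrite S0 !addr0. Qed.

Let Psi_a : Psi a = 0.
Proof. by rewrite /Psi fa subrr S0 addr0 scaler0. Qed.

Let Psi_smooth (U : set E) : open U -> U `<=` V -> smooth_on U Psi.
Proof.
move=> Uo UV k; have Cid : class_C k U (fun z => z - a).
  apply: (class_CD Uo); last exact: (class_C_cst Uo).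
  case: k => [|k]; first by move=> y _; exact: cvg_id.
  split=> [y _|u]; first exact: (@ex_diff _ _ _ _ _ _ _ (is_diff_id y)).
  by apply: (class_C_congr Uo _ (class_C_cst Uo k u)) => y _; rewrite derive_id.
apply: (class_CZ Uo); first exact: (class_C_cst Uo).
apply: (class_CD Uo) => //; apply: (@class_C_lin _ _ _ Uo _ _ k _ S).
  by move=> x u; apply: derive_row_linear.
apply: (class_CD Uo); last exact: (class_C_cst Uo).
exact: class_C_subset UV (f_smooth k).
Qed.

Let D_Psi u : 'D_u Psi a = u.
Proof.
have di := @ex_diff _ _ _ _ _ _ _ (is_diff_id a).
have dc (w : E) := differentiable_cst w a.
have d1 : differentiable (fun z => z - a) a := differentiableB di (dc a).
have d2 : differentiable (fun z => f z - a) a := differentiableB df_a (dc a).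
have [d3 D3] := derive_row_linear (f a - a) ('D_u (fun z => f z - a) a) S_linear.
have d4 : differentiable (fun z => S (f z - a)) a := differentiable_comp d2 d3.
have D4 : 'D_u (fun z => S (f z - a)) a = u.
  apply: etrans (derive_comp u d2 d3) _; apply: etrans D3 _; rewrite -[RHS]SS.
  congr S; apply: etrans (deriveB (diff_derivable df_a) (diff_derivable (dc a))) _.
  by rewrite derive_cst subr0.
have D1 : 'D_u (fun z => z - a) a = u.
  apply: etrans (deriveB (diff_derivable di) (diff_derivable (dc a))) _.
  by rewrite derive_cst subr0 derive_id.
have d5 : differentiable (fun z => z - a + S (f z - a)) a := differentiableD d1 d4.
apply: etrans (@deriveZ _ _ _ (fun z => z - a + S (f z - a)) (2^-1) a u
  (diff_derivable d5)) _.
have -> : 'D_u (fun z => z - a + S (f z - a)) a = u + u.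
  apply: etrans (deriveD (diff_derivable d1) (diff_derivable d4)) _.
  by rewrite D1 D4.
by apply/rowP => j; rewrite !mxE; field.
Qed.

(* [Psi] conjugates [f] to its differential at [a], so the lines of fixed
   vectors of the latter pull back to curves of fixed points of [f]. *)
Lemma involution_fixed_curve : exists (x : R -> E) (e : R),
  [/\ 0 < e, x 0 = a, forall t, `|t| < e -> V (x t) /\ f (x t) = x t,
      smooth_on (ball (0 : R^o) e) (fun t : R^o => x t) & 'D_1 x 0 = v].
Proof.
have nPsi : \forall z \near a, [/\ V z, f (f z) = z & Psi (f z) = S (Psi z)].
  near=> z; split; [by near: z|by near: z|].
  rewrite /Psi [RHS]SZ [S (z - a + _)]SD SS (near ffz z) //; congr (_ *: _); exact: addrC.
have [rho0 /= rho00 H0] : exists2 r, 0 < r & ball a r `<=` V.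
  by move/nbhs_ballP: Va => [r r0 ?]; exists r.
have Ps0 := Psi_smooth (ball_open a rho0) H0.
have nB : \forall z \near a, ball a rho0 z by exact: nbhsx_ballx.
have dPsi : \forall z \near a, differentiable Psi z.
  by apply: filterS nB => z; apply: (Ps0 1).1.
have cPsi u : {for a, continuous ('D_u Psi)}.
  by apply: (Ps0 1).2; rewrite inE; exact: ballxx.
have half0 : 0 < 2^-1 :> R by rewrite invr_gt0.
have nU : \forall z \near a, derive_mx Psi z \in unitmx.
  have nD := near_derive_close half0 dPsi cPsi D_Psi.
  near=> z; apply: derive_mx_unit; [by near: z|by near: z].
have /nbhs_ballP[rho1 /= rho10 H1] : \forall z \near a,
    [/\ V z, f (f z) = z, Psi (f z) = S (Psi z) & derive_mx Psi z \in unitmx].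
  by apply: filterS2 nPsi nU => z [].
pose U := ball a rho1; have Uo : open U by exact: ball_open.
have Ps : smooth_on U Psi by apply: Psi_smooth => // z /H1[].
have [rho rho_gt0 [rU rinj rsurj]] :=
  local_inverse dPsi cPsi D_Psi Psi_a (nbhsx_ballx a rho1 rho10).
(* The factor 2 is that of the Lipschitz bound on the inverse of [Psi]; adding 1 keeps [K] positive
   when [v = 0]. *)
pose K := `|v| *+ 2 + 1; have K0 : 0 < K by rewrite ltr_wpDl ?mulrn_wge0.
have vK : `|v| < K by rewrite /K mulr2n -addrA ltrDl ltr_wpDl.
have /choice[x xP] : forall t : R, exists y, `|t| < rho / 2 / K ->
    `|y - a| <= rho /\ Psi y = t *: v.
  move=> t; case: (ltP `|t| (rho / 2 / K)) => [tK|_]; last by exists a.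
  have [|y ya Py] := rsurj (t *: v); last by exists y.
  rewrite normrZ (le_trans (ler_wpM2l (normr_ge0 t) (ltW vK))) //.
  by rewrite -ler_pdivlMr // ltW.
have e10 : 0 < rho / 2 / K by rewrite !divr_gt0.
have x0 : x 0 = a.
  have [|xa Px] := xP 0; first by rewrite normr0.
  apply/eqP; rewrite -subr_eq0 -normr_le0.
  have aa : `|a - a| <= rho by rewrite subrr normr0 ltW.
  apply: le_trans (rinj _ _ xa aa) _.
  by rewrite Px Psi_a scale0r subr0 normr0 mul0rn.
have xlip s t : `|s| < rho / 2 / K -> `|t| < rho / 2 / K ->
    `|x s - x t| <= K * `|s - t|.
  move=> /xP[sa Ps'] /xP[ta Pt]; apply: le_trans (rinj _ _ sa ta) _.
  rewrite Ps' Pt -scalerBl normrZ -mulrnAr mulrC ler_wpM2r //.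
  by rewrite /K lerDl ler01.
have fc := differentiable_continuous df_a.
have /nbhs_ballP[d /= d0 Hd] : \forall z \near a, `|f z - a| < rho.
  have : f @ a --> a by rewrite -{2}fa; exact: fc.
  move=> /cvgrPdist_lt /(_ _ rho_gt0); apply: filterS => z.
  by rewrite distrC.
(* The first bound keeps [t *: v] where [Psi] can be inverted. The second keeps [f (x t)] in the
   ball where [Psi] is injective; there it equals [x t], both having the image [t *: v]. *)
pose e := Num.min (rho / 2 / K) (d / K).
have eP (t : R) : `|t| < e -> `|t| < rho / 2 / K /\ `|t| < d / K.
  by rewrite lt_min => /andP[].
have xU t : `|t| < e -> U (x t) by move=> /eP[/xP[/rU]].
have Psx t : `|t| < e -> Psi (x t) = t *: v by move=> /eP[/xP[]].
have xl s t : `|s| < e -> `|t| < e -> `|x s - x t| <= K * `|s - t|.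
  by move=> /eP[? _] /eP[? _]; exact: xlip.
have Pu y : U y -> derive_mx Psi y \in unitmx by move=> /H1[].
have e0 : 0 < e by rewrite lt_min e10 divr_gt0.
have t0 : `|0 : R| < e by rewrite normr0.
exists x, e; split=> //.
- move=> t te; have [Vx ffx Pfx _] := H1 _ (xU t te); split=> //.
  have [te1 te2] := eP t te; have [xa Px] := xP t te1.
  apply/eqP; rewrite -subr_eq0 -normr_le0.
  apply: le_trans (rinj _ _ _ xa) _.
    apply/ltW/Hd; rewrite -ball_normE /ball_ /= distrC.
    have := xl t 0 te t0; rewrite x0 subr0 => /le_lt_trans; apply.
    by rewrite mulrC -ltr_pdivlMr.
  by rewrite Pfx Px SZ /S fv subrr normr0 mul0rn.
- exact: inverse_curve_smooth Uo Ps Pu xU Psx K0 xl.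
have [_ ->] := inverse_curve_derive Ps Pu xU Psx K0 xl t0.
have -> : derive_mx Psi (x 0) = 1%:M; last by rewrite invmx1 mulmx1.
apply/row_matrixP => i; rewrite !rowE mulmx1 mul_derive_mx x0 ?D_Psi //.
exact: nbhs_singleton dPsi.
Unshelve. all: by end_near. Qed.

End FixedCurve.

(** * Differential of the involution *)

Section Involution.
Variables (R : realType) (n : nat) (G : groupTopologicalType).
Variable L : lie_group R n G.
Local Notation E := 'rV[R]_n.
Local Notation phi := (chart_fwd (chart1 L)).
Local Notation psi := (chart_bwd (chart1 L)).
Local Notation dom := (chart_dom (chart1 L)).
Local Notation cod := (chart_cod (chart1 L)).
Local Notation a := (phi 1%g).
Implicit Types (u v : E).

Variable sigma : G -> G.
Hypothesis sigma_invol : lie_involution L sigma.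

Let sig x := phi (sigma (psi x)).

Lemma involution_1 : sigma 1%g = 1%g.
Proof.
have [_ sM _] := sigma_invol.
have : sigma 1%g = (sigma 1 * sigma 1)%g by rewrite -sM mulg1.
by move/(congr1 (fun g => (sigma 1)^-1 * g)%g); rewrite mulVg mulgA mulVg mul1g => <-.
Qed.

Lemma near_involution_dom : \forall x \near a, dom (sigma (psi x)).
Proof.
have [[sc _] _ _] := sigma_invol.
apply: (cvg_comp _ _ (psi_cvg1 L) (sc 1%g)); rewrite involution_1.
exact: near_dom (chart1_dom L).
Qed.

Let sig_twice : twice_differentiable sig a.
Proof.
have [sS _ _] := sigma_invol.
have A1 := chart1_atlas L.
exact: (smooth_map_twice_differentiable sS A1 A1 (cod_a L)
  (nbhs_singleton near_involution_dom)).
Qed.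

Let dsig : differentiable sig a. Proof. exact: nbhs_singleton sig_twice.1. Qed.

Let sig_a : sig a = a. Proof. by rewrite /sig psi_a involution_1. Qed.

Let sigK : \forall x \near a, sig (sig x) = x.
Proof.
have [_ _ sK] := sigma_invol; have := near_involution_dom.
have := near_cod (cod_a L); apply: filterS2 => x cx dx.
by rewrite /sig chart_fwdK // sK chart_bwdK.
Qed.

Lemma diff1_involutionE v : diff1 L sigma v = 'D_v sig a.
Proof. exact: esym (deriveE v dsig). Qed.

Lemma diff1_involution_linear c u v :
  diff1 L sigma (c *: u + v) = c *: diff1 L sigma u + diff1 L sigma v.
Proof. by rewrite !diff1_involutionE; exact: derive_linearP. Qed.

Lemma diff1_involutionK v : diff1 L sigma (diff1 L sigma v) = v.
Proof.
rewrite !diff1_involutionE; have dsig' : differentiable sig (sig a) by rewrite sig_a.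
have := derive_comp v dsig dsig'; rewrite sig_a => Dff; apply: etrans (esym Dff) _.
by rewrite (near_eq_derive _ (_ : {near a, sig \o sig =1 id})) ?derive_id.
Qed.

Lemma diff1_involution_bracket u v :
  diff1 L sigma (lie_bracket L u v) =
    lie_bracket L (diff1 L sigma u) (diff1 L sigma v).
Proof.
have [_ sM _] := sigma_invol; rewrite !diff1_involutionE.
exact: (morph_lie_bracket sM near_involution_dom).
Qed.

Variable H : set G.
Hypothesis H_lower : connected_component (fixed_points sigma) 1%g `<=` H.
Hypothesis H_upper : H `<=` fixed_points sigma.

Lemma lie_subalgebra_fixed v : lie_subalgebra L H v <-> diff1 L sigma v = v.
Proof.
rewrite diff1_involutionE; split.
  move=> [c [e [e0 c0 Hc cS cv]]].
  have Be : ball (0 : R^o) e 0 by exact: ballxx.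
  have dc : differentiable (fun t : R^o => phi (c t)) 0 by exact: (cS 1).1.
  rewrite -cv derive1E.
  have dsc : differentiable sig ((fun t : R^o => phi (c t)) 0) by rewrite /= c0.
  have := derive_comp (1 : R^o) dc dsc; rewrite /= c0 => D.
  apply: etrans (esym D) _; apply: near_eq_derive.
  apply: filterS (nbhsx_ballx (0 : R^o) e e0) => t.
  rewrite -ball_normE /ball_ /= sub0r normrN => /Hc[/H_upper sc dt].
  by rewrite /= /sig chart_fwdK // sc.
move=> sv; pose V := [set x | cod x /\ dom (sigma (psi x))].
have [[sc sS] _ _] := sigma_invol.
have Vs : smooth_on V sig by apply: sS; exact: chart1_atlas.
have Va : \forall x \near a, V x.
  have := near_involution_dom; have := near_cod (cod_a L).
  by apply: filterS2.
have [x [e [e0 x0 xV xS xv]]] := involution_fixed_curve Vs Va sig_a sigK sv.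
have xB (t : R) : ball (0 : R^o) e t -> `|t| < e.
  by rewrite -ball_normE /ball_ /= sub0r normrN.
have phix t : `|t| < e -> phi (psi (x t)) = x t.
  by move=> /xV[[cx _] _]; rewrite chart_bwdK.
exists (psi \o x), e; split=> //.
- by rewrite /= x0 psi_a.
- move=> t te; have [[cx dx] sx] := xV t te; split; last exact: chart_bwd_dom.
  (* The curve is a connected set of fixed points through 1, hence it stays in the identity
     component. *)
  apply: H_lower; pose B := [set psi (x s) | s in [set s : R | `|s| < e]].
  apply: (@connected_component_max _ _ B) => //.
  + by exists 0; rewrite ?x0 ?psi_a //= normr0.
  + move=> _ [s /= /xV[[cs ds] ss] <-]; rewrite /fixed_points /=.
    by rewrite -{2}ss chart_fwdK.
  + apply: connected_continuous_connected.
      apply/connected_intervalP => p q /= pe qe r /andP[pr rq].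
      move: pe qe; rewrite !ltr_norml => /andP[pe _] /andP[_ qe].
      by rewrite (lt_le_trans pe pr) (le_lt_trans rq qe).
    apply: continuous_in_subspaceT => s; rewrite inE /= => se.
    apply: (@continuous_comp _ _ _ x psi).
      have dxs : differentiable (x : R^o -> E) s.
        by apply: (xS 1).1; rewrite -ball_normE /ball_ /= sub0r normrN.
      exact: (differentiable_continuous dxs).
    by apply: bwd_cvg; have [[]] := xV s se.
  + by exists t.
- move=> k; apply: class_C_congr (xS k); first exact: ball_open.
  by move=> t /xB te; rewrite /= phix.
rewrite derive1E -xv; apply: near_eq_derive.
apply: filterS (nbhsx_ballx (0 : R^o) e e0) => t /xB te.
by rewrite /= phix.
Qed.

End Involution.

(** * Orbits *)

Lemma mul_lin1_mx (R : pzRingType) m n (f : 'rV[R]_m -> 'rV[R]_n) u : linear f ->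
  u *m lin1_mx f = f u.
Proof.
move=> lf; pose fM := GRing.isLinear.Build _ _ _ _ f lf.
pose g : {linear 'rV[R]_m -> 'rV[R]_n} := HB.pack f fM.
exact: (mul_rV_lin1 g).
Qed.

Lemma diagonalizable_conj (F : fieldType) n (M A : 'M[F]_n) : M \in unitmx ->
  diagonalizable A -> diagonalizable (invmx M *m A *m M).
Proof.
move=> Mu [P Pu PA]; exists (P *m M); first by rewrite unitmx_mul Pu.
by rewrite /similar_to conjuMumx // -conjVmx // conjmxVK.
Qed.

Section AdjointMatrix.
Variables (R : realType) (n : nat) (G : groupTopologicalType).
Variable L : lie_group R n G.
Implicit Types u v X Y : 'rV[R]_n.

Lemma mul_ad_mx u v : v *m ad_mx L u = lie_bracket L u v.
Proof. by apply: mul_lin1_mx => c x y; exact: lie_bracket_linearr. Qed.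

Lemma ad_mx_linear : linear (ad_mx L).
Proof.
move=> c u v; have lE := fun w => lie_bracket_linearl L c u v w.
have E w X : lie_bracket L X w = w *m ad_mx L X by rewrite mul_ad_mx.
apply/row_matrixP => i; rewrite !rowE; move: (delta_mx 0 i) (lE (delta_mx 0 i)) => w.
rewrite !E; move: (ad_mx L _) (ad_mx L u) (ad_mx L v) => A B C ->.
by rewrite (mulmxDr w (c *: B)) -scalemxAr.
Qed.

Lemma ad_mx_bracket u v : ad_mx L (lie_bracket L u v) =
  ad_mx L v *m ad_mx L u - ad_mx L u *m ad_mx L v.
Proof.
have E w X : lie_bracket L X w = w *m ad_mx L X by rewrite mul_ad_mx.
have J (w : 'rV_n) : w *m ad_mx L (lie_bracket L u v) =
    w *m ad_mx L v *m ad_mx L u - w *m ad_mx L u *m ad_mx L v.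
  apply: etrans (esym (E w (lie_bracket L u v))) _.
  have -> : lie_bracket L (lie_bracket L u v) w =
      lie_bracket L u (lie_bracket L v w) - lie_bracket L v (lie_bracket L u w).
    by rewrite (lie_bracket_jacobi L u v) addrK.
  by rewrite (E (lie_bracket L v w)) (E (lie_bracket L u w)) !E.
apply/row_matrixP => i; rewrite !rowE J; move: (delta_mx 0 i) => w.
move: (ad_mx L u) (ad_mx L v) => A B.
by rewrite (mulmxBr w (B *m A)) !mulmxA.
Qed.

(** [Ad g] is an automorphism of the bracket, so [ad_mx L (Ad L g X)] is conjugate to [ad_mx L X] by
    the matrix of [Ad g]. *)
Lemma semisimple_element_Ad g X :
  semisimple_element L X -> semisimple_element L (Ad L g X).
Proof.
pose A h := lin1_mx (Ad L h); have AE h v : v *m A h = Ad L h v.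
  by apply: mul_lin1_mx => c x y; exact: Ad_linear.
have AV h : A h *m A h^-1%g = 1%:M.
  apply/row_matrixP => i; rewrite !rowE mulmxA mulmx1 !AE -AdM.
  by rewrite mulVg Ad1.
have [Au _] := mulmx1_unit (AV g).
have adA : ad_mx L (Ad L g X) = invmx (A g) *m ad_mx L X *m A g.
  apply: (can_inj (mulKmx Au)); rewrite !mulmxA mulmxV // mul1mx.
  apply/row_matrixP => i; rewrite !rowE !mulmxA; move: (delta_mx 0 i) => e.
  apply: etrans (mul_ad_mx _ _) _; rewrite AE -Ad_lie_bracket.
  by apply: esym; apply: etrans (AE _ _) _; rewrite (mul_ad_mx X e).
rewrite /semisimple_element adA !map_mxM map_invmx; apply: diagonalizable_conj.
by rewrite map_unitmx.
Qed.

Lemma orbit_tangentE (sigma : G -> G) (H : set G) Y u :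
  lie_involution L sigma ->
  connected_component (fixed_points sigma) 1%g `<=` H -> H `<=` fixed_points sigma ->
  orbit_tangent L H Y u <->
    exists2 v, diff1 L sigma v = v & lie_bracket L v Y = u.
Proof.
move=> sI Hl Hu; have E v : 'd (fun x => Ad L (chart_bwd (chart1 L) x) Y)
    (chart_fwd (chart1 L) 1%g) v = lie_bracket L v Y.
  by apply: etrans (esym (deriveE v (Ad_differentiable L Y))) _; exact: derive_Ad.
have F := lie_subalgebra_fixed sI Hl Hu.
split=> [[v /F sv <-]|[v /F sv <-]]; exists v => //; exact: esym.
Qed.

End AdjointMatrix.

Section Semisimple.
Variables (R : realType) (n : nat) (G : groupTopologicalType).
Variable L : lie_group R n.+1 G.
Hypothesis G_semisimple : semisimple_lie_group L.
Variable sigma : G -> G.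
Hypothesis sigma_involution : lie_involution L sigma.
Variable H : set G.
Hypothesis H_lower : connected_component (fixed_points sigma) 1%g `<=` H.
Hypothesis H_upper : H `<=` fixed_points sigma.

(** The equivalence at a single point of q. The theorem uses it at [X] in one direction and at every
    point of the orbit in the other. *)
Lemma nondegenerate_tangentP Y : q_space L sigma Y ->
  (forall u, orbit_tangent L H Y u ->
    (forall v, orbit_tangent L H Y v -> killing L u v = 0) -> u = 0) <->
  semisimple_element L Y.
Proof.
move=> Yq.
pose adM := GRing.isLinear.Build _ _ _ _ (ad_mx L) (ad_mx_linear L).
pose ad : {linear 'rV[R]_n.+1 -> 'M[R]_n.+1} := HB.pack (ad_mx L) adM.
pose s := lin1_mx (diff1 L sigma).
have sE v : v *m s = diff1 L sigma v.
  by apply: mul_lin1_mx => c x y; exact: (diff1_involution_linear sigma_involution).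
have brE u v : lie_bracket L u v = v *m ad u by exact: esym (mul_ad_mx L u v).
have br_xx := lie_bracket_xx L.
have ad_br : forall u v, ad (lie_bracket L u v) = ad v *m ad u - ad u *m ad v.
  exact: ad_mx_bracket.
have nd := killing_nondegenerate brE br_xx ad_br G_semisimple.
have ss : s *m s = 1%:M.
  apply/row_matrixP => i; rewrite !rowE mulmx1 mulmxA !sE.
  exact: (diff1_involutionK sigma_involution).
have s_br u v : lie_bracket L u v *m s = lie_bracket L (u *m s) (v *m s).
  by rewrite !sE; exact: (diff1_involution_bracket sigma_involution).
have Ys : Y *m s = - Y by rewrite sE.
have TE u := orbit_tangentE Y u sigma_involution H_lower H_upper.
split=> [ndY|ssY u /TE[a sa <-] aY].
  apply: (tangent_diagonalizable brE br_xx ad_br nd ss s_br Ys) => a sa aY.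
  apply: ndY; first by apply/TE; exists a; rewrite -?sE.
  by move=> _ /TE[b sb <-]; apply: aY; rewrite sE.
apply: (diagonalizable_tangent brE br_xx ad_br nd ss s_br Ys ssY); first by rewrite sE.
by move=> b sb; apply: aY; apply/TE; exists b; rewrite -?sE.
Qed.

End Semisimple.

Theorem mainTheorem1 (R : realType) (n : nat) (G : groupTopologicalType)
    (L : lie_group R n G)
    (G_connected : connected [set: G])
    (G_semisimple : semisimple_lie_group L)
    (G_noncompact : ~ compact [set: G])
    (sigma : G -> G) (sigma_involution : lie_involution L sigma)
    (H : set G) (H_subgroup : closed_subgroup H)
    (H_lower : connected_component (fixed_points sigma) 1%g `<=` H)
    (H_upper : H `<=` fixed_points sigma)
    (X : 'rV[R]_n) (X_q : q_space L sigma X)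
    (r : R) (r_gt0 : 0 < r)
    (orbit_sub : Ad_orbit L H X `<=` pseudo_hypersphere L sigma r) :
  pseudo_riemannian_orbit L H X <-> semisimple_element L X.
Proof.
(* The algebra is done in dimension [n.+1], where square matrices form a ring with powers and
   polynomials; in dimension 0 both sides hold. *)
case: n => [|n] in L G_semisimple sigma_involution X X_q orbit_sub *.
  split=> [_|_ Y _ u _ _]; last by rewrite (thinmx0 u).
  rewrite /semisimple_element [map_mx _ _](thinmx0 _).
  exact: diagonalizable0.
have ndP := nondegenerate_tangentP G_semisimple sigma_involution H_lower H_upper.
split=> [ndX|ssX Y YX].
  apply/(ndP X X_q)/ndX; exists 1%g; last exact: Ad1.
  by case: H_subgroup.
have [Yq _] := orbit_sub Y YX; apply/(ndP Y Yq).
by case: YX => h _ <-; exact: semisimple_element_Ad.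
Qed.
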